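(* The graph classes expressible by a set $\mathcal F$ of $2$-edge-coloured graphs on three vertices with at most two edges (i.e. $\mathcal F\subseteq\{3K_1, {}^r\overline{P_3}, {}^b\overline{P_3}, {}^rP_3, {}^bP_3, {}^{rb}P_3\}$) are exactly the following classes, each being expressed by the indicated set (where one is indicated): 1. all graphs, expressed e.g. by $\{{}^r\overline{P_3}\}$; 2. complete multipartite graphs; 3. clusters, expressed by $\{{}^rP_3,{}^bP_3,{}^{rb}P_3\}$; 4. $3K_1$-free graphs, expressed by $\{3K_1\}$; 5. complete graphs minus a matching, expressed by $\{3K_1,{}^r\overline{P_3},{}^b\overline{P_3}\}$; 6. independent sets (edgeless graphs) and complete graphs, expressed by $\{{}^r\overline{P_3},{}^b\overline{P_3},{}^rP_3,{}^bP_3,{}^{rb}P_3\}$; 7. disjoint unions of at most two cliques, expressed by $\{3K_1,{}^rP_3,{}^bP_3,{}^{rb}P_3\}$; 8. complete graphs and $2K_1$, expressed by $\{3K_1,{}^r\overline{P_3},{}^b\overline{P_3},{}^rP_3,{}^bP_3,{}^{rb}P_3\}$; 9. independent sets and complete graphs minus a matching, expressed by $\{{}^r\overline{P_3},{}^b\overline{P_3},{}^rP_3,{}^bP_3\}$; 10. $\{K_1+P_3, C_5\}$-free graphs, expressed by $\{{}^b\overline{P_3},{}^rP_3\}$; 11. $\{3K_1,C_5\}$-free graphs, expressed by $\{3K_1,{}^b\overline{P_3},{}^rP_3\}$; 12. joins of clusters, expressed by $\{{}^b\overline{P_3},{}^rP_3,{}^{rb}P_3\}$; 13. joins of clusters where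 each cluster contains at most two cliques, expressed by $\{3K_1,{}^b\overline{P_3},{}^rP_3,{}^{rb}P_3\}$; 14. co-bipartite graphs and clusters, expressed by $\{{}^b\overline{P_3},{}^rP_3,{}^bP_3\}$; 15. co-bipartite graphs, expressed by $\{3K_1,{}^rP_3,{}^bP_3\}$; 16. elementary graphs, expressed by $\{{}^rP_3,{}^bP_3\}$.
   Context: Graphs are finite and simple. A $2$-edge-colouring of $G$ assigns to every edge the colour red or blue (not necessarily properly). For a set $\mathcal F$ of $2$-edge-coloured graphs, a $2$-edge-colouring of $G$ is $\mathcal F$-free if no induced $2$-edge-coloured subgraph is isomorphic (preserving colours) to a member of $\mathcal F$. The set $\mathcal F$ expresses the class of all graphs that admit an $\mathcal F$-free $2$-edge-colouring. Patterns on three vertices: $3K_1$ is the edgeless graph; ${}^r\overline{P_3}$ (resp. ${}^b\overline{P_3}$) has exactly one edge, coloured red (resp. blue); ${}^rP_3$ (resp. ${}^bP_3$) is the path on three vertices with both edges red (resp. blue); ${}^{rb}P_3$ is the path on three vertices with one red and one blue edge. A cluster is a disjoint union of complete graphs. A graph is co-bipartite if it is the complement of a bipartite graph (its vertex set can be covered by at most two cliques). A complete graph minus a matching is a graph obtained from a complete graph by deleting a (possibly empty) matching. $+$ denotes disjoint union; the join of graphs is obtained from their disjoint union by adding all edges between different graphs; ''join of clusters'' means the join of one or more clusters. An elementary graph is, by definition, a graph admitting a $2$-edge-colouring with no monochromatic induced path on three vertices. For uncoloured graphs, being free of a set of graphs means containing no induced subgraph isomorphic to a member. *)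

(* Defs.v *)
From mathcomp Require Import all_boot.
From Stdlib Require List.

Set Implicit Arguments.
Unset Strict Implicit.
Unset Printing Implicit Defensive.

Record sgraph := SGraph {
  vertex :> finType;
  adj : rel vertex;
  adj_sym : symmetric adj;
  adj_irr : irreflexive adj }.

Definition edges (G : sgraph) : {set {set G}} :=
  [set [set p.1; p.2] | p in [pred p : G * G | adj p.1 p.2]].

Definition giso (G H : sgraph) : Prop :=
  exists2 f : G -> H, bijective f & forall x y, adj (f x) (f y) = adj x y.

Section Constructions.

Section Induced.
Variables (G : sgraph) (S : {set G}).
Let V := {x : G | x \in S}.
Definition induced_adj : rel V := fun x y => adj (val x) (val y).
Lemma induced_sym : symmetric induced_adj.
Proof. by move=> x y; apply: adj_sym. Qed.
Lemma induced_irr : irreflexive induced_adj.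
Proof. by move=> x; apply: adj_irr. Qed.
Definition induced : sgraph := SGraph induced_sym induced_irr.
End Induced.

Section Complement.
Variable G : sgraph.
Definition compl_adj : rel G := fun x y => (x != y) && ~~ adj x y.
Lemma compl_sym : symmetric compl_adj.
Proof. by move=> x y; rewrite /compl_adj eq_sym adj_sym. Qed.
Lemma compl_irr : irreflexive compl_adj.
Proof. by move=> x; rewrite /compl_adj eqxx. Qed.
Definition compl : sgraph := SGraph compl_sym compl_irr.
End Complement.

Section Deletion.
Variables (G : sgraph) (M : {set {set G}}).
Definition gdel_adj : rel G := fun x y => adj x y && ([set x; y] \notin M).
Lemma gdel_sym : symmetric gdel_adj.
Proof. by move=> x y; rewrite /gdel_adj adj_sym setUC. Qed.
Lemma gdel_irr : irreflexive gdel_adj.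
Proof. by move=> x; rewrite /gdel_adj adj_irr. Qed.
Definition gdel : sgraph := SGraph gdel_sym gdel_irr.
End Deletion.

Section SumJoin.
Variables (I : finType) (H : I -> sgraph).
Let V := {i : I & H i}.

(* [tagged_as u v] is the second component of [v], transported to the factor
   of [u] when both lie in the same factor; it is only used in that case. *)
Definition gsum_adj : rel V := fun u v =>
  (tag u == tag v) && adj (tagged u) (tagged_as u v).
Lemma gsum_sym : symmetric gsum_adj.
Proof.
case=> i x [j y]; rewrite /gsum_adj /= (eq_sym j).
by case: eqVneq => //= eij; case: _ / eij y => y; rewrite !tagged_asE adj_sym.
Qed.
Lemma gsum_irr : irreflexive gsum_adj.
Proof. by case=> i x; rewrite /gsum_adj tagged_asE adj_irr andbF. Qed.
Definition gsum : sgraph := SGraph gsum_sym gsum_irr.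

Definition gjoin_adj : rel V := fun u v => (tag u != tag v) || gsum_adj u v.
Lemma gjoin_sym : symmetric gjoin_adj.
Proof. by move=> u v; rewrite /gjoin_adj eq_sym gsum_sym. Qed.
Lemma gjoin_irr : irreflexive gjoin_adj.
Proof. by move=> u; rewrite /gjoin_adj eqxx gsum_irr. Qed.
Definition gjoin : sgraph := SGraph gjoin_sym gjoin_irr.
End SumJoin.

Definition disjoint_union (G1 G2 : sgraph) : sgraph :=
  gsum (fun b : bool => if b then G1 else G2).

Section Named.
Variable n : nat.

Lemma edgeless_sym : symmetric (fun _ _ : 'I_n => false). Proof. by []. Qed.
Lemma edgeless_irr : irreflexive (fun _ _ : 'I_n => false). Proof. by []. Qed.
Definition edgeless_graph : sgraph := SGraph edgeless_sym edgeless_irr.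

Definition path_adj : rel 'I_n :=
  fun i j => (j == i.+1 :> nat) || (i == j.+1 :> nat).
Lemma path_sym : symmetric path_adj.
Proof. by move=> i j; rewrite /path_adj orbC. Qed.
Lemma path_irr : irreflexive path_adj.
Proof. by move=> i; rewrite /path_adj orbb ltn_eqF. Qed.
Definition path_graph : sgraph := SGraph path_sym path_irr.

Definition cycle_adj : rel 'I_n := fun i j =>
  (i != j) && ((j == i.+1 %[mod n]) || (i == j.+1 %[mod n])).
Lemma cycle_sym : symmetric cycle_adj.
Proof. by move=> i j; rewrite /cycle_adj orbC eq_sym. Qed.
Lemma cycle_irr : irreflexive cycle_adj.
Proof. by move=> i; rewrite /cycle_adj eqxx. Qed.
Definition cycle_graph : sgraph := SGraph cycle_sym cycle_irr.
End Named.

End Constructions.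

Inductive colour := red | blue.

(* Only the values at the edges [[set x; y]] are ever used. *)
Definition colouring (G : sgraph) := {set G} -> colour.

Record cgraph := CGraph {
  base :> sgraph;
  col : colouring base }.

Definition ciso (G H : cgraph) : Prop :=
  exists f : G -> H,
    [/\ bijective f,
        forall x y, adj (f x) (f y) = adj x y
      & forall x y, adj x y -> col [set f x; f y] = col [set x; y]].

Definition cinduced (G : cgraph) (S : {set G}) : cgraph :=
  @CGraph (induced S) (fun e => col (val @: e)).

Definition free (F : cgraph -> Prop) (G : cgraph) : Prop :=
  forall (S : {set G}) (P : cgraph), F P -> ~ ciso (cinduced S) P.

Definition expresses (F : cgraph -> Prop) (C : sgraph -> Prop) : Prop :=
  forall G : sgraph, C G <-> exists c : colouring G, free F (CGraph c).

Definition three_vertices_le2_edges (P : cgraph) : Prop :=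
  #|P| = 3 /\ #|edges P| <= 2.

Definition members (T : Type) (s : seq T) : T -> Prop := fun x => List.In x s.

Definition monocol (k : colour) (G : sgraph) : cgraph :=
  @CGraph G (fun _ => k).

Definition P_3K1 : cgraph := monocol red (edgeless_graph 3).
Definition P_rcoP3 : cgraph := monocol red (compl (path_graph 3)).
Definition P_bcoP3 : cgraph := monocol blue (compl (path_graph 3)).
Definition P_rP3 : cgraph := monocol red (path_graph 3).
Definition P_bP3 : cgraph := monocol blue (path_graph 3).
Definition P_rbP3 : cgraph :=
  @CGraph (path_graph 3) (fun e => if ord0 \in e then red else blue).

Definition gfree (L : sgraph -> Prop) (G : sgraph) : Prop :=
  forall (S : {set G}) (H : sgraph), L H -> ~ giso (induced S) H.

Definition all_graphs (G : sgraph) : Prop := True.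

Definition edgeless (G : sgraph) : Prop := forall x y : G, ~~ adj x y.

Definition complete (G : sgraph) : Prop := forall x y : G, x != y -> adj x y.

Definition complete_multipartite (G : sgraph) : Prop :=
  exists (I : finType) (H : I -> sgraph),
    (forall i, edgeless (H i)) /\ giso G (gjoin H).

Definition cluster (G : sgraph) : Prop :=
  exists (I : finType) (H : I -> sgraph),
    (forall i, complete (H i)) /\ giso G (gsum H).

Definition cluster_le2 (G : sgraph) : Prop :=
  exists (I : finType) (H : I -> sgraph),
    [/\ #|I| <= 2, forall i, complete (H i) & giso G (gsum H)].

Definition join_of (C : sgraph -> Prop) (G : sgraph) : Prop :=
  exists (I : finType) (H : I -> sgraph),
    [/\ 0 < #|I|, forall i, C (H i) & giso G (gjoin H)].

Definition matching (G : sgraph) (M : {set {set G}}) : Prop :=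
  M \subset edges G /\ trivIset M.

Definition complete_minus_matching (G : sgraph) : Prop :=
  exists (H : sgraph) (M : {set {set H}}),
    [/\ complete H, matching M & giso G (gdel M)].

Definition bipartite (G : sgraph) : Prop :=
  exists f : G -> bool, forall x y, adj x y -> f x != f y.

Definition cobipartite (G : sgraph) : Prop := bipartite (compl G).

Definition monochromatic (G : cgraph) : Prop :=
  exists k : colour, forall e, e \in edges G -> col e = k.

Definition elementary (G : sgraph) : Prop :=
  exists c : colouring G, forall S : {set G},
    giso (induced S) (path_graph 3) ->
    ~ monochromatic (@cinduced (CGraph c) S).

Definition class_union (C D : sgraph -> Prop) : sgraph -> Prop :=
  fun G => C G \/ D G.

(* Main.v *)
Require Import Defs.
From mathcomp Require Import all_boot.
From Stdlib Require Import Classical.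
From Stdlib Require List.

(* Containing [3K1] in the set of patterns only intersects the class with the
   [3K1]-free graphs, and exchanging the colours changes nothing, so few sets
   have to be examined.  The interesting ones use the following observations.
   - If both monochromatic [P3] are forbidden, a [3K1]-free graph is
     co-bipartite: along a shortest odd cycle of the complement the chords
     [w_i w_(i+2)] would have to alternate in colour.
   - If moreover the blue complement of [P3] is forbidden, a blue edge is
     incompatible with an independent triple, so that a graph with such a
     triple is entirely red, hence a cluster.
   - If only the blue complement of [P3] is forbidden among one-edge patterns,
     one may colour red exactly the edges that have a common non-neighbour; two
     red edges forming an induced [P3] then yield a [K1 + P3] or a [C5]. *)

Set Implicit Arguments.
Unset Strict Implicit.
Unset Printing Implicit Defensive.

(** The forbidden set is an arbitrary predicate on coloured graphs, possibly holding many copies of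
    one pattern, and containment is stated with induced subgraphs and isomorphisms. Everything is
    therefore moved to triples of vertices: a forbidden set becomes a predicate on six pattern
    names, and most classes become conditions on a few vertices. The number sixteen arises as
    follows. If for some colour [k] neither the one-edge pattern nor the path of colour [k] is
    forbidden, the constant colouring [k] serves every graph. Otherwise each colour forbids its
    one-edge pattern, its path or both; up to exchanging colours, and with or without the mixed
    path, this leaves eight more classes. Nine classes and their nine intersections with the
    $3K_1$-free graphs would make eighteen, but complete graphs minus a matching and co-bipartite
    graphs each arise from two of the nine. *)

(** * Embeddings in place of induced subgraphs *)

Definition embeds (P G : cgraph) : Prop := exists g : P -> G,
  [/\ injective g, forall x y, adj (g x) (g y) = adj x y
    & forall x y, adj x y -> col [set g x; g y] = col [set x; y]].

Lemma imset2_set2 (A B : finType) (f : A -> B) (x y : A) :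
  f @: [set x; y] = [set f x; f y].
Proof. by rewrite imsetU !imset_set1. Qed.

Lemma embedsP (P G : cgraph) :
  embeds P G <-> exists S : {set G}, ciso (cinduced S) P.
Proof.
split=> [[g [g_inj gA gC]]|[S [f [[h fK hK] fA fC]]]].
  pose S := g @: setT.
  have gS x : g x \in S by apply: imset_f.
  pose h x : {v | v \in S} := Sub (g x) (gS x).
  have h_inj : injective h by move=> x y /(congr1 val)/g_inj.
  have [|f hK fK] := inj_card_bij h_inj.
    by rewrite card_sig card_imset // cardsT.
  exists S, f; split; first by exists h.
    by move=> u v; rewrite -{2}(fK u) -{2}(fK v) [RHS]gA.
  move=> u v; rewrite -{1}(fK u) -{1}(fK v) [X in is_true X -> _]gA => /gC <-.
  rewrite /= imset2_set2.
  by rewrite -[in RHS](fK u) -[in RHS](fK v).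
exists (val \o h); split=> [|x y|x y xy].
- exact: inj_comp val_inj (can_inj hK).
- by have := fA (h x) (h y); rewrite !hK => ->.
- have := fC (h x) (h y); rewrite -fA !hK => /(_ xy) ->.
  by rewrite /= imset2_set2.
Qed.

Lemma freeE F G : free F G <-> forall P, F P -> ~ embeds P G.
Proof.
split=> [GF P FP /embedsP[S]|GF S P FP SP]; first exact: GF.
by apply: (GF P FP); apply/embedsP; exists S.
Qed.

Definition gembeds (H G : sgraph) : Prop := exists2 g : H -> G,
  injective g & forall x y, adj (g x) (g y) = adj x y.

Lemma gfreeE L G : gfree L G <-> forall H, L H -> ~ gembeds H G.
Proof.
have E H : gembeds H G <-> exists S : {set G}, giso (induced S) H.
  (* Painting both graphs red makes the colour condition trivial, so the coloured case applies. *)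
  have [E1 E2] := embedsP (monocol red H) (monocol red G).
  split=> [[g g_inj gA]|[S [f f_bij fA]]].
    by have [|S [f [f_bij fA _]]] := E1; [exists g | exists S, f].
  have [|g [g_inj gA _]] := E2; last by exists g.
  by exists S, f.
split=> [GF H LH /E[S]|GF S H LH SH]; first exact: GF.
by apply: (GF H LH); apply/E; exists S.
Qed.

(** * Triples of vertices *)

Section Triples.
Variable G : sgraph.
Implicit Types x y z : G.

Definition indep3 x y z :=
  [&& x != y, y != z, x != z, ~~ adj x y, ~~ adj y z & ~~ adj x z].
(** The isolated vertex is the middle argument [y]. *)
Definition coP3 x y z := [&& ~~ adj x y, ~~ adj y z & adj x z].
Definition P3 x y z := [&& x != z, adj x y, adj y z & ~~ adj x z].

(** These three conditions describe the $3K_1$-free graphs, the complete multipartite graphs and the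
    clusters. *)
Definition indep3_free := forall x y z, ~~ indep3 x y z.
Definition coP3_free := forall x y z, ~~ coP3 x y z.
Definition P3_free := forall x y z, ~~ P3 x y z.

Lemma adj_neq x y : adj x y -> x != y.
Proof. by apply: contraTneq => ->; rewrite adj_irr. Qed.

Lemma P3C x y z : P3 x y z = P3 z y x.
Proof.
rewrite /P3 eq_sym (adj_sym x y) (adj_sym y z) (adj_sym x z).
by rewrite !andbA (andbAC (z != x)).
Qed.

Lemma P3_uniq x y z : P3 x y z -> uniq [:: x; y; z].
Proof.
case/and4P=> xz /adj_neq xy /adj_neq yz _ /=.
by rewrite !inE negb_or xy xz yz.
Qed.

Lemma coP3_uniq x y z : coP3 x y z -> uniq [:: x; y; z].
Proof.
case/and3P=> xy yz xz; have [xNy yNz] : x != y /\ y != z.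
  by split; apply/eqP=> E; move: xy yz; rewrite ?E ?xz // -?E ?xz.
by rewrite /= !inE negb_or xNy yNz (adj_neq xz).
Qed.

Lemma indep3_uniq x y z : indep3 x y z -> uniq [:: x; y; z].
Proof. by case/and4P=> xy yz xz _; rewrite /= !inE negb_or xy xz yz. Qed.

End Triples.

(** * The six patterns and their occurrences *)

Inductive pattern := K3 | Edge of colour | Path of colour | MixedPath.

Definition pgraph (p : pattern) : cgraph :=
  match p with
  | K3 => P_3K1
  | Edge red => P_rcoP3 | Edge blue => P_bcoP3
  | Path red => P_rP3 | Path blue => P_bP3
  | MixedPath => P_rbP3
  end.

(** The colour is a parameter, so that later arguments treat a colour [k] and its opposite
    symmetrically. [MixedPath] is read from its red end. *)
Definition occurs (p : pattern) (G : cgraph) (x y z : G) : Prop :=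
  match p with
  | K3 => indep3 x y z
  | Edge k => coP3 x y z /\ col [set x; z] = k
  | Path k => [/\ P3 x y z, col [set x; y] = k & col [set y; z] = k]
  | MixedPath => [/\ P3 x y z, col [set x; y] = red & col [set y; z] = blue]
  end.

Definition avoids (p : pattern) (G : cgraph) : Prop :=
  forall x y z : G, ~ occurs p x y z.

Lemma occurs_uniq p (G : cgraph) (x y z : G) :
  occurs p x y z -> uniq [:: x; y; z].
Proof.
case: p => [|k|k|] /=; first exact: indep3_uniq.
- by case=> /coP3_uniq.
- by case=> /P3_uniq.
- by case=> /P3_uniq.
Qed.

Lemma card3P (T : finType) (x y z : T) :
  #|T| = 3 -> uniq [:: x; y; z] -> forall t, [\/ t = x, t = y | t = z].
Proof.
move=> T3 xyz t; have : t \in [:: x; y; z].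
  have -> : [:: x; y; z] =i T; last by [].
  by apply/subset_cardP; [rewrite (card_uniqP xyz) T3 | apply/subsetP].
by rewrite !inE => /or3P[]/eqP->; [constructor 1|constructor 2|constructor 3].
Qed.

Lemma embeds3 (P G : cgraph) (x y z : P) (a b c : G) :
  #|P| = 3 -> uniq [:: x; y; z] -> uniq [:: a; b; c] ->
  adj a b = adj x y -> adj b c = adj y z -> adj a c = adj x z ->
  (adj x y -> col [set a; b] = col [set x; y]) ->
  (adj y z -> col [set b; c] = col [set y; z]) ->
  (adj x z -> col [set a; c] = col [set x; z]) -> embeds P G.
Proof.
move=> P3 xyz abc Axy Ayz Axz Cxy Cyz Cxz.
pose g v := if v == x then a else if v == y then b else c.
have vP := card3P P3 xyz.
move: xyz abc; rewrite /= !inE !negb_or !andbT.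
move=> /andP[/andP[xy xz] yz] /andP[/andP[ab ac] bc].
have gx : g x = a by rewrite /g eqxx.
have gy : g y = b by rewrite /g eq_sym (negPf xy) eqxx.
have gz : g z = c by rewrite /g !(eq_sym z) (negPf xz) (negPf yz).
exists g; split=> v w; case: (vP v) (vP w) => -> []->;
  rewrite ?gx ?gy ?gz ?adj_irr // 1?[[set b; a]]setUC 1?[[set c; a]]setUC
    1?[[set c; b]]setUC 1?[[set y; x]]setUC 1?[[set z; x]]setUC
    1?[[set z; y]]setUC 1?(adj_sym y x) 1?(adj_sym z x) 1?(adj_sym z y)
    1?(adj_sym b a) 1?(adj_sym c a) 1?(adj_sym c b) //.
all: by move/eqP; rewrite ?(negPf ab) ?(negPf ac) ?(negPf bc) // eq_sym
  ?(negPf ab) ?(negPf ac) ?(negPf bc).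
Qed.

(** An occurrence of [p] fixes all three adjacencies and the colours of the edges present; hence any
    two three-vertex graphs with the same pattern are interchangeable, whatever colours they carry
    off their edges. *)
Lemma embeds_occurs p (P G : cgraph) (x y z : P) :
  #|P| = 3 -> occurs p x y z ->
  embeds P G <-> exists a b c : G, occurs p a b c.
Proof.
move=> card_P pxyz; split=> [[g [g_inj gA gC]]|[a [b [c pabc]]]].
  exists (g x), (g y), (g z).
  case: p pxyz => [|k|k|] /=; rewrite /indep3 /coP3 /P3 ?(inj_eq g_inj) ?gA //.
  - by case=> xyz <-; split=> //; apply: gC; case/and3P: xyz.
  - by case=> xyz xy yz; split=> //; [rewrite -xy | rewrite -yz]; apply: gC; case/and4P: xyz.
  - by case=> xyz <- <-; split=> //; apply: gC; case/and4P: xyz.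
have abc := occurs_uniq pabc; have xyz := occurs_uniq pxyz.
have := embeds3 card_P xyz abc.
case: p pabc pxyz => [|k|k|] /=; rewrite /indep3 /coP3 /P3.
- case/and5P=> _ _ _ /negPf-> /andP[/negPf-> /negPf->].
  by case/and5P=> _ _ _ /negPf-> /andP[/negPf-> /negPf->]; apply.
- case=> /and3P[/negPf-> /negPf-> ->] ->.
  by case=> /and3P[/negPf-> /negPf-> ->] ->; apply.
- case=> /and4P[_ -> -> /negPf->] -> ->.
  by case=> /and4P[_ -> -> /negPf->] -> ->; apply.
case=> /and4P[_ -> -> /negPf->] -> ->.
by case=> /and4P[_ -> -> /negPf->] -> ->; apply.
Qed.

Lemma card3_exists (T : finType) :
  #|T| = 3 -> exists x y z : T, uniq [:: x; y; z].
Proof.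
rewrite cardE; case E: (enum T) (enum_uniq T) => [|x [|y [|z [|]]]] // Tu _.
by exists x, y, z.
Qed.

Lemma occurs_exists (P : cgraph) : three_vertices_le2_edges P ->
  exists p (x y z : P), occurs p x y z.
Proof.
case=> /card3_exists[x [y [z xyz]]] P2.
(* A triangle would have three distinct edges, against the bound of two. *)
have notK : ~~ [&& adj x y, adj y z & adj x z].
  apply: contraL P2 => /and3P[xy yz xz]; rewrite -ltnNge.
  pose s := [:: [set x; y]; [set y; z]; [set x; z]].
  have s_uniq : uniq s.
    move: xyz; rewrite /= !inE !negb_or !andbT.
    move=> /andP[/andP[Nxy Nxz] Nyz].
    apply/andP; split; last first.
      by apply/eqP=> /setP/(_ y); rewrite !inE eqxx (eq_sym y x) (negPf Nxy) (negPf Nyz).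
    apply/andP; split; apply/eqP=> /setP.
      by move/(_ x); rewrite !inE eqxx (negPf Nxy) (negPf Nxz).
    by move/(_ y); rewrite !inE eqxx orbT eq_sym (negPf Nxy) (negPf Nyz).
  rewrite -[3]/(size s) -(card_uniqP s_uniq); apply/subset_leq_card/subsetP.
  move=> e; rewrite !inE => /or3P[]/eqP->; apply/imsetP.
  - by exists (x, y).
  - by exists (y, z).
  - by exists (x, z).
move: xyz; rewrite /= !inE !negb_or !andbT => /andP[/andP[xy xz] yz].
(* A path coloured blue, then red is the mixed path read backwards. *)
have path (u v w : P) : P3 u v w -> exists p (x y z : P), occurs p x y z.
  move=> uvw; case E1: (col [set u; v]); case E2: (col [set v; w]).
  - by exists (Path red), u, v, w.
  - by exists MixedPath, u, v, w.
  - by exists MixedPath, w, v, u; split; rewrite 1?P3C // setUC.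
  - by exists (Path blue), u, v, w.
have edge (u v w : P) : coP3 u v w -> exists p (x y z : P), occurs p x y z.
  by move=> uvw; exists (Edge (col [set u; w])), u, v, w.
case Axy: (adj x y) (notK); case Ayz: (adj y z); case Axz: (adj x z) => // _.
- by apply: (path x y z); rewrite /P3 xz Axy Ayz Axz.
- by apply: (path y x z); rewrite /P3 yz adj_sym Axy Ayz Axz.
- by apply: (edge x z y); rewrite /coP3 (adj_sym z) Axy Ayz Axz.
- by apply: (path x z y); rewrite /P3 xy (adj_sym z) Axy Ayz Axz.
- by apply: (edge y x z); rewrite /coP3 (adj_sym y x) Axy Ayz Axz.
- by apply: (edge x y z); rewrite /coP3 Axy Ayz Axz.
- by exists K3, x, y, z; rewrite /= /indep3 xy yz xz Axy Ayz Axz.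
Qed.

Lemma pgraph_occurs p : exists x y z : pgraph p, occurs p x y z.
Proof.
pose o1 : 'I_3 := Ordinal (isT : 1 < 3); pose o2 : 'I_3 := Ordinal (isT : 2 < 3).
by case: p => [|[]|[]|]; exists ord0, o1, o2; try split; rewrite //= !inE.
Qed.

Lemma pgraph_card p : #|pgraph p| = 3.
Proof. by case: p => [|[]|[]|]; rewrite /= card_ord. Qed.

Lemma occurs_le2 (P : cgraph) p (x y z : P) :
  #|P| = 3 -> occurs p x y z -> #|edges P| <= 2.
Proof.
move=> card_P pxyz; have vP := card3P card_P (occurs_uniq pxyz).
have eP (e : {set P}) : e \in edges (P) ->
    [\/ e = [set x; y] /\ adj x y, e = [set y; z] /\ adj y z
      | e = [set x; z] /\ adj x z].
  case/imsetP=> -[u v]; rewrite inE /= => uv ->.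
  case: (vP u) (vP v) uv => -> [] ->; rewrite ?adj_irr // => uv.
  - by constructor 1.
  - by constructor 3.
  - by constructor 1; rewrite setUC adj_sym.
  - by constructor 2.
  - by constructor 3; rewrite setUC adj_sym.
  - by constructor 2; rewrite setUC adj_sym.
pose E := if adj x z then [set [set x; z]] else [set [set x; y]; [set y; z]].
apply: (@leq_trans #|E|); last first.
  by rewrite /E; case: ifP => _; rewrite ?cards1 ?cards2 //; case: eqP.
apply/subset_leq_card/subsetP=> e /eP; rewrite /E.
have notK : adj x z -> ~~ adj x y /\ ~~ adj y z.
  case: p pxyz {vP eP} => [|k|k|] /=.
  - by case/and5P=> _ _ _ -> /andP[-> _].
  - by case=> /and3P[-> -> _].
  - by case=> /and4P[_ _ _ /negPf->].
  - by case=> /and4P[_ _ _ /negPf->].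
case: ifP => xz.
  have [/negPf-> /negPf->] := notK xz.
  by case=> -[-> // _]; rewrite !inE.
by case=> -[-> //]; rewrite !inE eqxx ?orbT.
Qed.

Lemma pgraph_le2 p : three_vertices_le2_edges (pgraph p).
Proof.
have [x [y [z pxyz]]] := pgraph_occurs p.
by split; [exact: pgraph_card | exact: occurs_le2 (pgraph_card p) pxyz].
Qed.

Lemma free_members (s : seq pattern) G :
  free (members (map pgraph s)) G <-> forall p, List.In p s -> avoids p G.
Proof.
rewrite freeE; split=> [GF p sp x y z pxyz|GF P /List.in_map_iff[p [<- sp]]].
  apply: (GF (pgraph p)); first by apply/List.in_map_iff; exists p.
  have [a [b [c pabc]]] := pgraph_occurs p.
  by apply/(embeds_occurs _ (pgraph_card p) pabc); exists x, y, z.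
have [a [b [c pabc]]] := pgraph_occurs p.
by move/(embeds_occurs _ (pgraph_card p) pabc)=> [x [y [z]]]; apply: GF.
Qed.

(** Freeness only depends on which patterns occur in members of [F]; this turns any admissible [F],
    finite or not, into a subset of the six names. *)
Lemma free_avoids (F : cgraph -> Prop) :
  (forall P, F P -> three_vertices_le2_edges P) ->
  exists s : pattern -> Prop,
    forall G, free F G <-> forall p, s p -> avoids p G.
Proof.
move=> F3; exists (fun p => exists2 P, F P & exists x y z : P, occurs p x y z).
move=> G; rewrite freeE; split=> [GF p [P FP [a [b [c pabc]]]] x y z pxyz|GF P FP].
  apply: (GF P FP); apply/(embeds_occurs _ _ pabc); first by case: (F3 P FP).
  by exists x, y, z.
have [p [a [b [c pabc]]]] := occurs_exists (F3 P FP).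
move/(embeds_occurs _ (proj1 (F3 P FP)) pabc)=> [x [y [z]]]; apply: GF.
by exists P => //; exists a, b, c.
Qed.

(** * Sums and joins of the fibres of a map *)

Section Fibres.
Variables (G : sgraph) (I : finType) (f : G -> I).

(** Decompositions into cliques, independent parts or join factors are all produced below as fibres
    of a labelling map. Fibres may be empty, so the label type can be as large as convenient. *)
Definition fibre i : sgraph := induced [set x | f x == i].

Let to_sum (x : G) : {i : I & fibre i} :=
  Tagged fibre (Sub x (etrans (in_set _ x) (eqxx (f x))) : fibre (f x)).
Let of_sum (u : {i : I & fibre i}) : G := val (tagged u).

Lemma to_sum_bij : bijective to_sum.
Proof.
exists of_sum => //; case=> i [x xi]; rewrite /to_sum /of_sum /=.
have /eqP fx := etrans (esym (in_set _ x)) xi; case: _ / fx xi => xi.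
by congr Tagged; apply: val_inj.
Qed.

Lemma gsum_adj_to_sum x y :
  @adj (gsum fibre) (to_sum x) (to_sum y) = (f x == f y) && adj x y.
Proof.
rewrite /= /gsum_adj /=; case: eqP => //= fxy.
(* Writing [y] through its image allows that image to be generalised and taken apart, so that the
   equality of tags can be substituted. *)
have {2}-> : y = of_sum (to_sum y) by [].
move: (to_sum y) (erefl : tag (to_sum y) = f y) => -[j u] /= fj.
by rewrite -fxy in fj; subst j; rewrite tagged_asE.
Qed.

Lemma giso_gsum_fibre : (forall x y, adj x y -> f x = f y) ->
  giso G (gsum fibre).
Proof.
move=> fA; exists to_sum; first exact: to_sum_bij.
move=> x y; rewrite gsum_adj_to_sum andbC; case E: (adj x y) => //.
by rewrite (fA _ _ E) eqxx.
Qed.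

Lemma giso_gjoin_fibre : (forall x y, f x != f y -> adj x y) ->
  giso G (gjoin fibre).
Proof.
move=> fA; exists to_sum; first exact: to_sum_bij.
move=> x y; rewrite -[LHS]/((f x != f y) || @adj (gsum fibre) (to_sum x) (to_sum y)).
rewrite gsum_adj_to_sum; case: eqVneq => //= fxy.
by rewrite fA.
Qed.

End Fibres.

Section SumAdj.
Variables (I : finType) (H : I -> sgraph).

Lemma gsum_adjE i (a b : H i) :
  @adj (gsum H) (Tagged H a) (Tagged H b) = adj a b.
Proof. by rewrite /= /gsum_adj /= eqxx tagged_asE. Qed.

Lemma gjoin_adjE i (a b : H i) :
  @adj (gjoin H) (Tagged H a) (Tagged H b) = adj a b.
Proof. by rewrite -gsum_adjE /= /gjoin_adj /= eqxx. Qed.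

Lemma gsum_adj_tag (u v : gsum H) : adj u v -> tag u = tag v.
Proof. by case/andP=> /eqP. Qed.

Lemma gjoin_adj_tag (u v : gjoin H) : ~~ adj u v -> tag u = tag v.
Proof. by rewrite negb_or negbK => /andP[/eqP]. Qed.

End SumAdj.

(** * The classes as conditions on few vertices *)

Lemma indep3_pigeon (G : sgraph) (I : finType) (f : G -> I) :
  #|I| <= 2 -> (forall x y, x != y -> f x = f y -> adj x y) -> indep3_free G.
Proof.
move=> I2 fA x y z; apply/negP=> /and5P[xy yz xz nxy /andP[nyz nxz]].
have : uniq [:: f x; f y; f z].
  rewrite /= !inE !negb_or !andbT.
  by apply/andP; split; [apply/andP; split|]; apply/eqP => /fA; apply/implyP;
    rewrite ?xy ?xz ?yz /=.
by move/card_uniqP; have := max_card [in [:: f x; f y; f z]] => /[swap]-> /leq_trans/(_ I2).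
Qed.

Lemma complete_fibre (G : sgraph) (I : finType) (f : G -> I) i :
  (forall x y, x != y -> f x = f y -> adj x y) -> complete (fibre f i).
Proof.
move=> fA [x xi] [y yi] xy; rewrite /= /induced_adj /=.
move: (xi) (yi); rewrite !inE => /eqP fx /eqP fy; apply: fA; last by rewrite fx.
by apply: contra xy => /eqP E; apply/eqP/val_inj.
Qed.

(** In a cluster these sets are the cliques, and hence labels for the components. *)
Definition closed_nbhd (G : sgraph) (x : G) := [set y | (y == x) || adj x y].

Lemma P3_free_nbhd (G : sgraph) : P3_free G ->
  forall x y : G, x != y -> (closed_nbhd x == closed_nbhd y) = adj x y.
Proof.
move=> GP x y xy; apply/eqP/idP => [/setP/(_ y)|xAy].
  by rewrite !inE eqxx eq_sym (negPf xy).
(* A neighbour [w] of [u] outside the closed neighbourhood of [v] would give the induced path [v],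
   [u], [w]. *)
have sub (u v : G) : adj u v -> closed_nbhd u \subset closed_nbhd v.
  move=> uv; apply/subsetP=> w; rewrite !inE => /orP[/eqP->|uw].
    by rewrite adj_sym uv orbT.
  apply: (contraNT _ (GP v u w)); rewrite negb_or => /andP[wv vw].
  by rewrite /P3 eq_sym wv adj_sym uv uw.
by apply/eqP; rewrite eqEsubset !sub // adj_sym.
Qed.

Lemma P3_free_gsum (G : sgraph) (I : finType) (H : I -> sgraph) :
  (forall i, complete (H i)) -> giso G (gsum H) -> P3_free G.
Proof.
move=> HC [f /bij_inj f_inj fA] x y z; apply/negP=> /and4P[xz xy yz].
apply/negP; rewrite negbK -fA; rewrite -!fA in xy yz.
have := etrans (gsum_adj_tag xy) (gsum_adj_tag yz).
rewrite -(inj_eq f_inj) in xz; case: (f x) (f z) xz {xy yz} => i a [j b] ab ij.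
have {}ij : i = j := ij; subst j; rewrite gsum_adjE; apply: HC.
by apply: contra ab => /eqP->.
Qed.

Lemma clusterE G : cluster G <-> P3_free G.
Proof.
split=> [[I [H [HC]]]|GP]; first exact: P3_free_gsum.
exists {set G}, (fibre (@closed_nbhd G)); split.
  move=> i; apply: complete_fibre => x y xy /eqP.
  by rewrite P3_free_nbhd.
apply: giso_gsum_fibre => x y xy; apply/eqP.
by rewrite P3_free_nbhd // adj_neq.
Qed.

Lemma gsum_indep3 (G : sgraph) (I : finType) (H : I -> sgraph) :
  #|I| <= 2 -> (forall i, complete (H i)) -> giso G (gsum H) ->
  indep3_free G.
Proof.
move=> I2 HC [f /bij_inj f_inj fA].
apply: (indep3_pigeon (f := fun x => tag (f x)) I2) => x y.
rewrite -(inj_eq f_inj) -fA; case: (f x) (f y) => i a [j b] ab ij.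
have {}ij : i = j := ij; subst j.
by rewrite gsum_adjE; apply: HC; apply: contra ab => /eqP->.
Qed.

Lemma cluster_le2E G : cluster_le2 G <-> P3_free G /\ indep3_free G.
Proof.
split=> [[I [H [I2 HC GH]]]|[GP GI]].
  by split; [apply: P3_free_gsum HC GH | apply: gsum_indep3 GH].
have [x0 _|G0] := pickP G; last first.
  exists bool, (fibre (fun _ : G => true)); split; first by rewrite card_bool.
    by move=> i; apply: complete_fibre => x; have := G0 x.
  by apply: giso_gsum_fibre.
(* One clique is the closed neighbourhood of an arbitrary [x0], the other is the rest: two
   non-adjacent vertices of the rest would be independent together with [x0]. *)
pose f x := x \in closed_nbhd x0; exists bool, (fibre f).
split; first by rewrite card_bool.
  move=> i; apply: complete_fibre => x y xy; rewrite /f !inE.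
  have [xx0|x'x] /= := eqVneq x x0.
    by subst x; rewrite eq_sym (negPf xy) /= => <-.
  have [->|y'y] /= := eqVneq y x0; first by rewrite adj_sym.
  move=> E; case xA: (adj x0 x) E => /esym yA.
    apply: (contraNT _ (GP x x0 y)); by rewrite /P3 xy yA (adj_sym x x0) xA.
  apply: (contraNT _ (GI x x0 y)).
  by rewrite /indep3 xy x'x yA (adj_sym x x0) xA (eq_sym x0) y'y.
apply: giso_gsum_fibre => x y xy; rewrite /f !inE.
have [x'x|x'x] /= := eqVneq x x0; first by rewrite -x'x xy orbT.
have [y'y|y'y] /= := eqVneq y x0; first by rewrite -y'y adj_sym xy.
apply/idP/idP => [A|A]; [apply: (contraNT _ (GP x0 x y))|apply: (contraNT _ (GP x0 y x))];
  by rewrite /P3 A 1?(adj_sym y x) xy eq_sym ?x'x ?y'y.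
Qed.

Lemma complete_multipartiteE G : complete_multipartite G <-> coP3_free G.
Proof.
split=> [[I [H [HE [f _ fA]]]]|GP].
  move=> x y z; apply/negP=> /and3P[]; rewrite -!fA => xy yz; apply/negP.
  have := etrans (gjoin_adj_tag xy) (gjoin_adj_tag yz).
  case: (f x) (f z) {xy yz} => i a [j b] ij; have {}ij : i = j := ij; subst j.
  by rewrite gjoin_adjE; apply: HE.
(* Without induced complements of $P_3$, non-adjacency is an equivalence relation, and [f x] is the
   class of [x]. *)
pose f (x : G) := [set y | ~~ adj x y].
have fE (x y : G) : (f x == f y) = ~~ adj x y.
  apply/eqP/idP => [/setP/(_ y)|xy]; first by rewrite !inE adj_irr => ->.
  apply/setP=> u; rewrite !inE; congr negb; apply/idP/idP => [A|A].
    by apply: (contraNT _ (GP x y u)) => B; rewrite /coP3 xy B.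
  by apply: (contraNT _ (GP y x u)) => B; rewrite /coP3 adj_sym xy B.
exists {set G}, (fibre f); split.
  move=> i [x xi] [y yi]; rewrite /= /induced_adj /= -fE.
  by move: (xi) (yi); rewrite !inE => /eqP-> /eqP->.
by apply: giso_gjoin_fibre => x y; rewrite fE negbK.
Qed.

Lemma complete_minus_matchingE G :
  complete_minus_matching G <-> coP3_free G /\ indep3_free G.
Proof.
split=> [[H [M [HC [_ /trivIsetP MI] [f /bij_inj f_inj fA]]]]|[GP GI]].
  (* If [x] were non-adjacent to both [y] and [z], two different edges of the matching would meet in
     [f x]. *)
  have two (x y z : G) : x != y -> x != z -> y != z -> ~~ adj x y -> adj x z.
    rewrite -!fA -!(inj_eq f_inj) /= /gdel_adj => xy xz yz.
    rewrite !HC //= negbK => xyM; apply: contraT; rewrite negbK => xzM.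
    case: (eqVneq [set f x; f y] [set f x; f z]) => [/setP/(_ (f z))|/MI].
      by rewrite !inE eqxx orbT eq_sym (negPf xz) eq_sym (negPf yz).
    move/(_ xyM xzM)/disjoint_setI0/setP/(_ (f x)).
    by rewrite !inE eqxx.
  split=> x y z; apply/negP.
    move=> A; have := coP3_uniq A; rewrite /= !inE negb_or andbT.
    case/andP=> /andP[xy xz] yz; case/and3P: A; rewrite (adj_sym x y) => yx nyz _.
    by rewrite (two y x z) // eq_sym in nyz.
  case/and5P=> xy yz xz nxy /andP[_].
  by rewrite (two x y z).
pose adjT : rel G := fun x y => x != y.
have symT : symmetric adjT by move=> x y; rewrite /adjT eq_sym.
have irrT : irreflexive adjT by move=> x; rewrite /adjT eqxx.
pose K := SGraph symT irrT.
exists K, (edges (compl G)); split=> //.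
  split.
    apply/subsetP=> e /imsetP[[x y]]; rewrite inE /= => /andP[xy _] ->.
    by apply/imsetP; exists (x, y).
  apply/trivIsetP=> A B.
  case/imsetP=> -[a b]; rewrite inE /= => /andP[ab nab] ->.
  case/imsetP=> -[c d]; rewrite inE /= => /andP[cd ncd] ->.
  (* Two distinct non-neighbours of [x] form with it either an independent triple or a complement of
     $P_3$; so the complement of [G] is a matching. *)
  have two (x y z : G) : x != y -> ~~ adj x y -> x != z -> ~~ adj x z -> y = z :> G.
    move=> xy nxy xz nxz; apply/eqP; apply: contraT => yz.
    case yAz: (adj y z).
      by have := GP y x z; rewrite /coP3 adj_sym nxy nxz yAz.
    by have := GI y x z; rewrite /indep3 adj_sym nxy nxz yAz yz eq_sym xy xz.
  apply: contraR => /pred0Pn[x]; rewrite /= !inE.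
  have dc : d != c by rewrite eq_sym.
  have ba : b != a by rewrite eq_sym.
  have nba : ~~ @adj G b a by rewrite adj_sym.
  have ndc : ~~ @adj G d c by rewrite adj_sym.
  case/andP=> /orP[]/eqP-> /orP[]/eqP E; subst.
  - by rewrite (two _ _ _ ab nab cd ncd).
  - by rewrite (two _ _ _ ab nab dc ndc) setUC.
  - by rewrite (two _ _ _ ba nba cd ncd) setUC.
  - by rewrite (two _ _ _ ba nba dc ndc).
exists id; first by exists id.
move=> x y; rewrite /= /gdel_adj /= /adjT.
have -> : ([set x; y] \in edges (compl G)) = (x != y) && ~~ adj x y.
  apply/imsetP/idP => [[[a b]]|xy]; last by exists (x, y).
  rewrite inE /= => /andP[ab nab] /setP E.
  have := E a; have := E b; rewrite !inE !eqxx orbT /=.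
  case/orP=> /eqP bE /orP[]/eqP aE; move: ab nab; rewrite aE bE ?eqxx //.
    by rewrite eq_sym adj_sym => -> ->.
  by move=> -> ->.
case: eqVneq => [->|_] /=; first by rewrite adj_irr.
by rewrite negbK.
Qed.

(* Equivalently, no edge lies both in an induced [P3] and in an induced
   complement of [P3]. *)
Definition join_condition (G : sgraph) := forall x y z u : G,
  P3 x y z -> u != y -> ~~ adj u y -> adj u x.

(** Non-adjacent vertices share a factor: [z] lies with [x], and [u] with [y]. The two factors
    differ, since otherwise the path would lie in a single cluster; hence [u] and [x] are joined. *)
Lemma join_condition_gjoin (G : sgraph) (I : finType) (H : I -> sgraph) :
  (forall i, P3_free (H i)) -> giso G (gjoin H) -> join_condition G.
Proof.
move=> HP [f /bij_inj f_inj fA] x y z u.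
rewrite /P3 -!fA -!(inj_eq f_inj) => /and4P[xz xy yz nxz] uy nuy.
have := gjoin_adj_tag nxz; have := gjoin_adj_tag nuy; move: xz xy yz nxz uy nuy.
case: (f x) (f y) (f z) (f u) => i x' [j y'] [k z'] [l u'].
move=> xz xy yz nxz uy nuy E1 E2.
have {}E1 : l = j := E1; have {}E2 : i = k := E2; subst k l.
case: (eqVneq j i) => [E|ji]; last by apply/orP; left.
subst j; move: xz xy yz nxz; rewrite !gjoin_adjE => xz xy yz nxz.
have := HP i x' y' z'; rewrite /P3 xy yz nxz andbT.
by have -> : x' != z' by apply: contra xz => /eqP->.
Qed.

(** The join factors are the connected components of the complement. *)
Lemma join_condition_fibre (G : sgraph) : join_condition G ->
  exists f : G -> {set G}, (forall x y, f x != f y -> adj x y) /\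
    forall i, P3_free (fibre f i).
Proof.
move=> GJ; pose e := @compl_adj G; pose f x := [set y | connect e x y].
have eC : connect_sym e by apply: sym_connect_sym; apply: compl_sym.
exists f; split=> [x y|i].
  apply: contraR => nxy; apply/eqP/setP=> u; rewrite !inE.
  case: (eqVneq x y) => [->//|xy].
  by apply: (same_connect eC); apply: connect1; rewrite /e /compl_adj xy.
move=> [x xi] [y yi] [z zi]; apply/negP=> /and4P[xz xy yz nxz].
have {xy yz nxz} xyz : P3 x y z.
  by apply/and4P; split=> //; apply: contra xz => /eqP E; apply/eqP/val_inj.
have : connect e y x.
  move: (xi) (yi); rewrite !inE => /eqP <- /eqP/setP/(_ x).
  by rewrite !inE connect0.
case/connectP=> p.
(* Along a walk in the complement starting at [y], every vertex remains the middle of an induced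
   path from [x] to [z]: the condition is applied at both ends. Such a walk cannot arrive at [x]
   itself. *)
have closed q : path e y q -> P3 x (last y q) z.
  elim/last_ind: q => [//|q u IH]; rewrite rcons_path last_rcons.
  move=> /andP[/IH A /andP[uq nuq]].
  have [B C] : adj u x /\ adj u z.
    split.
      by apply: (GJ x (last y q) z) => //; rewrite 1?eq_sym 1?adj_sym.
    by apply: (GJ z (last y q) x); rewrite 1?P3C // 1?eq_sym 1?adj_sym.
  by case/and4P: xyz => xz' _ _ nxz; rewrite /P3 xz' adj_sym B C.
move=> /closed A E; rewrite -E in A.
by case/and4P: A => _; rewrite adj_irr.
Qed.

Lemma join_of_clusterE G : join_of cluster G <-> join_condition G.
Proof.
split=> [[I [H [_ HC]]]|/join_condition_fibre[f [fA fP]]].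
  by apply: join_condition_gjoin => i; apply/clusterE.
exists {set G}, (fibre f); split; last exact: giso_gjoin_fibre.
  by apply/card_gt0P; exists set0.
by move=> i; apply/clusterE.
Qed.

Lemma indep3_free_induced (G : sgraph) (S : {set G}) :
  indep3_free G -> indep3_free (induced S).
Proof.
by move=> GI x y z; have := GI (val x) (val y) (val z); rewrite /indep3 !(inj_eq val_inj).
Qed.

(** An independent triple of a join lies within one factor. *)
Lemma join_of_cluster_le2E G :
  join_of cluster_le2 G <-> join_of cluster G /\ indep3_free G.
Proof.
split=> [[I [H [I0 HC GH]]]|[/join_of_clusterE/join_condition_fibre[f [fA fP]] GI]].
  split; first by exists I, H; split=> // i; apply/clusterE; case/cluster_le2E: (HC i).
  have [f /bij_inj f_inj fA] := GH.
  move=> x y z; rewrite /indep3 -!fA -!(inj_eq f_inj).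
  apply/negP=> /and5P[xy yz xz nxy /andP[nyz nxz]].
  have := gjoin_adj_tag nxy; have := gjoin_adj_tag nyz.
  move: xy yz xz nxy nyz nxz.
  case: (f x) (f y) (f z) => i x' [j y'] [k z'] xy yz xz nxy nyz nxz E1 E2.
  have {}E1 : j = k := E1; have {}E2 : i = j := E2; subst j k.
  have /cluster_le2E[_ /(_ x' y' z')] := HC i; move: nxy nyz nxz.
  rewrite /indep3 !gjoin_adjE => -> -> ->.
  have sub (a b : H i) : Tagged H a != Tagged H b -> a != b.
    by apply: contra => /eqP->.
  by rewrite !sub.
exists {set G}, (fibre f); split; last exact: giso_gjoin_fibre.
  by apply/card_gt0P; exists set0.
by move=> i; apply/cluster_le2E; split=> //; apply: indep3_free_induced.
Qed.

(** * Forbidden induced subgraphs without colours *)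

Lemma edgeless3_gembeds G :
  gembeds (edgeless_graph 3) G <-> exists x y z : G, indep3 x y z.
Proof.
have [E1 E2] := @embeds_occurs K3 P_3K1 (monocol red G) ord0
  (Ordinal (isT : 1 < 3)) (Ordinal (isT : 2 < 3)) (card_ord 3) isT.
split=> [[g g_inj gA]|xyz]; first by apply: E1; exists g.
by have [g [g_inj gA _]] := E2 xyz; exists g.
Qed.

Definition K1P3 (G : sgraph) (u x y z : G) :=
  [&& P3 x y z, u != y, ~~ adj u x, ~~ adj u y & ~~ adj u z].

Definition C5 (G : sgraph) (a b c d e : G) :=
  [&& adj a b, adj b c, adj c d, adj d e & adj e a] &&
  [&& ~~ adj a c, ~~ adj b d, ~~ adj c e, ~~ adj d a & ~~ adj e b].

Lemma K1P3_uniq (G : sgraph) (u x y z : G) :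
  K1P3 u x y z -> uniq [:: u; x; y; z].
Proof.
case/and5P=> xyz uy ux nuy uz; rewrite cons_uniq (P3_uniq xyz) andbT.
case/and4P: xyz => _ xy yz _; rewrite !inE !negb_or uy /=.
apply/andP; split; apply/eqP=> E; subst u; first by rewrite xy in nuy.
by rewrite adj_sym yz in nuy.
Qed.

Lemma C5_uniq (G : sgraph) (a b c d e : G) :
  C5 a b c d e -> uniq [:: a; b; c; d; e].
Proof.
case/andP=> /and5P[ab bc cd de ea] /and5P[ac bd ce da eb].
(* Two vertices of the cycle without an edge between them are told apart by a vertex adjacent to
   exactly one of them. *)
have sep (x y z : G) : adj x y -> ~~ adj z y -> x != z.
  by move=> xy; apply: contraNneq => <-.
rewrite /= !inE !negb_or !(adj_neq ab, adj_neq bc, adj_neq cd, adj_neq de).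
rewrite (eq_sym a e) (adj_neq ea) /= andbT.
apply/and3P; split.
- by rewrite (sep a e c) ?(sep a b d) // adj_sym.
- by rewrite (sep b a d) ?(sep b c e) // adj_sym.
- by rewrite (sep c b e) // adj_sym.
Qed.

Lemma K1P3_gembeds G :
  gembeds (disjoint_union (edgeless_graph 1) (path_graph 3)) G <->
  exists u x y z : G, K1P3 u x y z.
Proof.
pose H (b : bool) := if b then edgeless_graph 1 else path_graph 3.
pose o i (lti : i < 3) : {b : bool & H b} := Tagged H (Ordinal lti : H false).
pose o0 : {b : bool & H b} := Tagged H (ord0 : H true).
split=> [[g g_inj gA]|[u [x [y [z uxyz]]]]].
  exists (g o0), (g (o 0 isT)), (g (o 1 isT)), (g (o 2 isT)).
  have oA i j (lti : i < 3) (ltj : j < 3) :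
      @adj (gsum H) (o i lti) (o j ltj) = path_adj (Ordinal lti) (Ordinal ltj).
    exact: (@gsum_adjE _ H false).
  by rewrite /K1P3 /P3 !gA !(inj_eq g_inj) !oA eq_Tagged.
(* The vertices of the disjoint union are numbered as positions in [[:: u; x; y; z]]: the isolated
   vertex is 0, and the path is shifted by one. *)
pose f (b : bool) : H b -> 'I_4 :=
  match b with true => fun=> ord0 | false => fun i => inord i.+1 end.
pose g (v : {b : bool & H b}) := nth u [:: u; x; y; z] (f (tag v) (tagged v)).
have lt3 (w : 'I_3) : w.+1 < 4 by rewrite ltnS ltn_ord.
exists g.
  move=> [b v] [c w] /eqP; rewrite nth_uniq ?ltn_ord ?K1P3_uniq //.
  move: b v c w => [] v [] w; rewrite //= ?inordK ?lt3 //.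
  - by move=> _; congr Tagged; rewrite (ord1 v) (ord1 w).
  - by move=> /eqP[vw]; congr Tagged; apply: val_inj.
case/and5P: (uxyz) => /and4P[_ xy yz xz] _ ux uy uz.
move=> [b v] [c w].
move: b v c w => [] v [] w; rewrite /g /= ?inordK ?lt3 // /gsum_adj /=.
- exact: adj_irr.
- by case: w => [[|[|[|]]] ?] //=; rewrite (negPf ux, negPf uy, negPf uz).
- by case: v => [[|[|[|]]] ?] //=; rewrite adj_sym (negPf ux, negPf uy, negPf uz).
rewrite tagged_asE; case: v => [[|[|[|v]]] ltv] //; case: w => [[|[|[|w]]] ltw] //=;
  rewrite ?adj_irr ?xy ?yz ?(negPf xz) // adj_sym ?xy ?yz ?(negPf xz) //.
Qed.

Lemma C5_gembeds G :
  gembeds (cycle_graph 5) G <-> exists a b c d e : G, C5 a b c d e.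
Proof.
pose o i (lti : i < 5) : cycle_graph 5 := Ordinal lti.
split=> [[g g_inj gA]|[a [b [c [d [e abcde]]]]]].
  exists (g (o 0 isT)), (g (o 1 isT)), (g (o 2 isT)), (g (o 3 isT)), (g (o 4 isT)).
  by rewrite /C5 !gA.
exists (fun i : 'I_5 => nth a [:: a; b; c; d; e] i).
  move=> i j /eqP; rewrite nth_uniq ?C5_uniq ?ltn_ord // => /eqP.
  exact: val_inj.
case/andP: abcde => /and5P[ab bc cd de ea] /and5P[ac bd ce da eb].
move=> [i lti] [j ltj].
do 5?[case: i lti => [|i] lti] => //; do 5?[case: j ltj => [|j] ltj] => //=;
  rewrite ?adj_irr ?ab ?bc ?cd ?de ?ea ?(negPf ac) ?(negPf bd) ?(negPf ce)
  ?(negPf da) ?(negPf eb) //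
  adj_sym ?ab ?bc ?cd ?de ?ea ?(negPf ac) ?(negPf bd) ?(negPf ce)
  ?(negPf da) ?(negPf eb) //.
Qed.

Lemma gfree_edgeless3E G :
  gfree (members [:: edgeless_graph 3]) G <-> indep3_free G.
Proof.
rewrite gfreeE; split=> [GF x y z|GI H [<-|[]]].
  apply/negP=> xyz; apply: (GF (edgeless_graph 3)); first by left.
  by apply/edgeless3_gembeds; exists x, y, z.
by move/edgeless3_gembeds=> [x [y [z]]]; apply/negP.
Qed.

Lemma gfree_K1P3_C5E G :
  gfree (members [:: disjoint_union (edgeless_graph 1) (path_graph 3);
                     cycle_graph 5]) G <->
  (forall u x y z : G, ~~ K1P3 u x y z) /\ (forall a b c d e : G, ~~ C5 a b c d e).
Proof.
rewrite gfreeE; split=> [GF|[GK GC] H].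
  split=> [u x y z|a b c d e]; apply/negP=> E.
    apply: (GF (disjoint_union _ _)); first by left.
    by apply/K1P3_gembeds; exists u, x, y, z.
  apply: (GF (cycle_graph 5)); first by right; left.
  by apply/C5_gembeds; exists a, b, c, d, e.
case=> [<-|[<-|[]]].
  by move/K1P3_gembeds=> [u [x [y [z]]]]; apply/negP.
by move/C5_gembeds=> [a [b [c [d [e]]]]]; apply/negP.
Qed.

(** The isolated vertex of $K_1+P_3$ and the two ends of its path form a $3K_1$. *)
Lemma gfree_edgeless3_C5E G :
  gfree (members [:: edgeless_graph 3; cycle_graph 5]) G <->
  gfree (members [:: disjoint_union (edgeless_graph 1) (path_graph 3);
                     cycle_graph 5]) G /\ indep3_free G.
Proof.
rewrite gfree_K1P3_C5E gfreeE; split=> [GF|[[GK GC] GI] H].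
  have GI : indep3_free G.
    move=> x y z; apply/negP=> xyz.
    apply: (GF (edgeless_graph 3)); first by left.
    by apply/edgeless3_gembeds; exists x, y, z.
  split=> //; split=> [u x y z|a b c d e]; apply/negP=> E.
    have := GI u x z; have := K1P3_uniq E; rewrite /= !inE !negb_or.
    case/and5P: E => /and4P[xz _ _ nxz] _ ux _ uz.
    by rewrite /indep3 xz nxz ux uz => /andP[/and3P[-> _ ->]].
  apply: (GF (cycle_graph 5)); first by right; left.
  by apply/C5_gembeds; exists a, b, c, d, e.
case=> [<-|[<-|[]]].
  by move/edgeless3_gembeds=> [x [y [z]]]; apply/negP.
by move/C5_gembeds=> [a [b [c [d [e]]]]]; apply/negP.
Qed.

Definition other (k : colour) := match k with red => blue | blue => red end.

Lemma otherP k l : l <> k -> l = other k.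
Proof. by case: k; case: l. Qed.

Lemma set2_inj (T : finType) (x y a b : T) : [set x; y] = [set a; b] ->
  (x = a /\ y = b) \/ (x = b /\ y = a).
Proof.
move=> /setP E; have := E x; have := E y; have := E a; have := E b.
rewrite !inE !eqxx /= ?orbT => bE aE /esym/orP yE /esym/orP xE.
case: xE yE => /eqP xE [] /eqP yE; subst x y; [|by left|by right|].
  by move: bE; rewrite orbb => /eqP->; left.
by move: aE; rewrite orbb => /eqP->; left.
Qed.

(** A colouring takes the edge as a set, so symmetry of [q] is what makes the result independent of
    the order in which its ends are recovered. *)
Lemma colouring_exists (G : sgraph) (k : colour) (q : rel G) : symmetric q ->
  exists c : colouring G, forall x y, c [set x; y] = if q x y then k else other k.
Proof.
move=> qC.
exists (fun e => if [exists x, exists y, (e == [set x; y]) && q x y]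
                 then k else other k) => x y.
case: ifPn => [/existsP[a /existsP[b /andP[/eqP /set2_inj E qab]]]|].
  by case: E => -[-> ->]; [|rewrite qC]; rewrite qab.
by move=> /existsPn/(_ x)/existsPn/(_ y); rewrite eqxx /= => /negPf->.
Qed.

(** * Bipartite graphs and odd closed walks *)

Section ClosedWalks.
Variables (T : finType) (e : rel T).
Hypothesis eC : symmetric e.

(** A periodic sequence, so that going round needs no reduction of indices. Vertices may repeat;
    minimality of the length will rule this out. *)
Definition closed_walk n (w : nat -> T) :=
  (forall i, e (w i) (w i.+1)) /\ (forall i, w (i + n) = w i).

Lemma close_walk n (u : nat -> T) : 0 < n ->
  (forall j, j.+1 < n -> e (u j) (u j.+1)) -> e (u n.-1) (u 0) ->
  exists w, closed_walk n w.
Proof.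
move=> n0 uA uL; exists (fun i => u (i %% n)); split=> i; last by rewrite modnDr.
rewrite modnS; case: ifP => [dv|ndv].
  suff -> : i %% n = n.-1 by [].
  have : (i %% n).+1 %% n == 0 by rewrite -addn1 modnDml addn1.
  have := ltn_pmod i n0; case: n {uA uL} n0 dv => // n _ _.
  rewrite ltnS leq_eqVlt => /orP[/eqP->//|lt].
  by rewrite modn_small.
have := ltn_pmod i.+1 n0; rewrite modnS ndv; exact: uA.
Qed.

Lemma bipartite_or_odd_walk :
  (exists f : T -> bool, forall x y, e x y -> f x != f y) \/
  (exists n w, odd n /\ closed_walk n w).
Proof.
(* The bipartite double cover: a walk between the two copies of a vertex projects to an odd closed
   walk. If there is none, the copies reached from one root per component define the two sides. *)
pose e2 : rel (T * bool) := fun u v => e u.1 v.1 && (u.2 != v.2).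
have e2C : connect_sym e2.
  by apply: sym_connect_sym => u v; rewrite /e2 eC eq_sym.
have [[x /connectP[p xp xl]]|none] := classic (exists x, connect e2 (x, false) (x, true)).
  right; exists (size p).
  have parity u q : path e2 u q -> (last u q).2 = u.2 (+) odd (size q).
    elim: q u => [|v q IH] u /=; first by rewrite addbF.
    move=> /andP[/andP[_ uv] /IH->].
    by move: uv; case: (u.2); case: (v.2); case: (odd _).
  have p_odd : odd (size p) by have := parity _ _ xp; rewrite -xl.
  have p0 : 0 < size p by case: (p) p_odd.
  have /pathP xpA := xp.
  (* Only the first [size p] vertices are kept, since the last one projects to [x] again. *)
  have [|||w] := @close_walk (size p) (fun j => (nth (x, false) ((x, false) :: p) j).1).
  - exact: p0.
  - by move=> j jp; have /andP[] := xpA (x, false) j (ltnW jp).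
  - have := xpA (x, false) (size p).-1; rewrite prednK // leqnn.
    by move=> /(_ isT)/andP[]; rewrite nth_last -xl.
  by move=> wn; exists w.
left; pose r := root e; exists (fun x => connect e2 (r x, false) (x, false)) => x y xy.
have rxy : r x = r y by apply/rootP; [exact: sym_connect_sym | exact: connect1].
have step b : connect e2 (r x, false) (x, b) -> connect e2 (r x, false) (y, ~~ b).
  move=> xb; apply: connect_trans xb _; apply: connect1.
  by rewrite /e2 /= xy; case: b.
have both v : connect e2 (r x, false) (v, false) -> ~~ connect e2 (r x, false) (v, true).
  move=> vf; apply/negP => vt; apply: none; exists v.
  by apply: connect_trans vt; rewrite e2C.
have lift a p : path e a p -> exists b, connect e2 (a, false) (last a p, b).
  elim/last_ind: p => [_|p v IH]; first by exists false.
  rewrite rcons_path last_rcons => /andP[/IH[b ab] bv].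
  exists (~~ b); apply: connect_trans ab _; apply: connect1.
  by rewrite /e2 /= bv; case: b.
have [b xb] : exists b, connect e2 (r x, false) (x, b).
  have /connectP[p rp xE] : connect e (r x) x.
    by rewrite sym_connect_sym // connect_root.
  by have := lift _ _ rp; rewrite -xE.
rewrite -rxy; have yb := step _ xb.
case: b xb yb => /= [xt yf|xf yt].
  by rewrite yf; apply/eqP=> xf; have := both _ xf; rewrite xt.
by rewrite xf; apply/eqP=> /esym yf; have := both _ yf; rewrite yt.
Qed.

End ClosedWalks.

(** * Colourings without monochromatic induced paths *)

Section NoMonochromaticPath.
Variables (G : sgraph) (c : colouring G).

Definition no_mono_P3 :=
  forall x y z : G, P3 x y z -> c [set x; y] <> c [set y; z].

Hypothesis cP : no_mono_P3.

(** Any two edges of the claw form an induced path, so its three edges would need three colours. *)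
Lemma no_mono_claw (v x y z : G) :
  indep3 x y z -> adj v x -> adj v y -> adj v z -> False.
Proof.
case/and5P=> xy yz xz nxy /andP[nyz nxz] vx vy vz.
have path a b : a != b -> ~~ adj a b -> adj v a -> adj v b ->
    c [set v; a] <> c [set v; b].
  move=> ab nab va vb; rewrite (setUC [set v] [set a]); apply: cP.
  by rewrite /P3 ab nab adj_sym va vb.
have := path _ _ xy nxy vx vy; have := path _ _ yz nyz vy vz.
have := path _ _ xz nxz vx vz.
by case: (c _); case: (c _); case: (c _).
Qed.

(* In a shortest odd closed walk [w] of the complement, [w i] is adjacent in
   [G] to [w (i + d)] for [2 <= d <= n - 2], and the colours of these edges
   alternate with [d].  Hence the edges [w i, w (i + 2)] and
   [w (i + 2), w (i + 4)] have different colours for all [i], which is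
   impossible around an odd cycle. *)
Lemma no_odd_closed_walk : indep3_free G ->
  forall n w, odd n -> ~ closed_walk (@compl_adj G) n w.
Proof.
move=> GI n; have [m] := ubnP n; elim: m n => // m IH n; rewrite ltnS => nm.
move=> w n_odd [wA wn].
have n0 : 0 < n by case: (n) n_odd.
have short d u : odd d -> d < n ->
    (forall j, compl_adj (u j) (u j.+1)) -> ~~ @compl_adj G (u d.-1) (u 0).
  move=> d_odd dn uA; apply/negP=> uL.
  have [|w' /IH] := close_walk _ (fun j _ => uA j) uL; first by case: (d) d_odd.
  by apply=> //; apply: leq_trans nm.
have shortw i d : odd d -> d < n -> ~~ @compl_adj G (w (i + d.-1)) (w i).
  move=> d_odd dn; have := @short d (fun j => w (i + j)) d_odd dn; rewrite addn0.
  by apply=> j; rewrite addnS.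
have far i d : 1 < d -> d.+1 < n -> w i != w (i + d) /\ adj (w i) (w (i + d)).
  move=> d1 dn; have dn' : d < n := ltnW dn.
  have ne : w i != w (i + d).
    (* A repeated vertex splits the closed walk into closed walks of lengths [d] and [n - d], one of
       which is odd. *)
    apply/eqP=> E; have [d_odd|d_even] := boolP (odd d).
      have := shortw i d d_odd dn'; rewrite E.
      by rewrite -{2}(prednK (ltnW d1)) addnS wA.
    have nd_odd : odd (n - d) by rewrite oddB ?(ltnW dn') // n_odd.
    have := shortw (i + d) (n - d) nd_odd; rewrite ltn_subrL (ltnW d1) n0.
    move=> /(_ isT); rewrite -E -[X in compl_adj _ X]wn.
    have -> : i + n = (i + d + (n - d).-1).+1.
      by rewrite -addnS prednK ?subn_gt0 // -addnA subnKC // ltnW.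
    by rewrite wA.
  split=> //; apply: contraT => nadj.
  (* A chord in the complement closes walks of lengths [d + 1] and [n - d + 1]; the odd one is
     shorter than [n]. *)
  have [d_odd|d_even] := boolP (odd d).
    have nd_odd : odd (n - d).+1 by rewrite /= oddB ?(ltnW dn') // n_odd d_odd.
    have := shortw (i + d) (n - d).+1 nd_odd.
    rewrite -subSn ?(ltnW dn') // ltn_subLR ?ltnS; last by apply: leqW; exact: ltnW.
    rewrite -add2n leq_add2r => /(_ d1); rewrite subSn ?(ltnW dn') //=.
    by rewrite -addnA subnKC ?(ltnW dn') // wn /compl_adj ne nadj.
  have := shortw i d.+1; rewrite /= d_even => /(_ isT dn).
  by rewrite compl_sym /compl_adj ne nadj.
(* Length 1 would be a loop, length 3 an independent triple. *)
have n4 : 4 < n.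
  case: n n_odd wA wn {IH nm n0 short shortw far} => [|[|[|[|[|n]]]]] // _ wA wn.
    by have := wA 0; rewrite (wn 0 : w 1 = w 0) [compl_adj _ _]compl_irr.
  have /andP[ab nab] := wA 0; have /andP[bc nbc] := wA 1.
  have /andP[cd ncd] := wA 2; move: cd ncd; rewrite (wn 0 : w 3 = w 0) => ca nca.
  have := GI (w 0) (w 1) (w 2).
  by rewrite /indep3 ab nab bc nbc eq_sym ca adj_sym nca.
pose C i d := if c [set w i; w (i + d)] is red then true else false.
have alt i d : 1 < d -> d.+2 < n -> C i d.+1 = ~~ C i d.
  move=> d1 dn; have [ne1 A1] := far i d d1 (ltnW dn).
  have [ne2 A2] := far i d.+1 (ltnW d1) dn.
  have : c [set w (i + d); w i] <> c [set w i; w (i + d.+1)].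
    apply: cP; rewrite /P3 adj_sym A1 A2.
    by rewrite addnS; have /andP[-> ->] := wA (i + d).
  by rewrite /C setUC; case: (c _); case: (c _).
(* The consecutive vertices [w (i + d)] and [w (i + d.+1)] are non-adjacent, so they form an induced
   path with middle [w i]; this alternation is iterated from distance 2. *)
have altn i d : d.+3 < n -> C i d.+2 = C i 2 (+) odd d.
  elim: d => [|d IHd] dn; first by rewrite addbF.
  by rewrite alt // IHd ?(ltnW dn) //= addbN.
(* Seen from [w i.+2], the edge to [w i] spans the distance [n - 2], an odd number [n - 4] of
   alternations away from distance 2. *)
have flip i : C i.+2 2 = ~~ C i 2.
  have -> : C i 2 = C i.+2 (n - 2).
    rewrite /C addn2 -[in RHS]addn2 -addnA subnKC; last by do 3 apply: ltnW.
    by rewrite wn addn2 setUC.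
  have -> : n - 2 = (n - 4).+2 by case: (n) n4 => [|[|[|[|k]]]] // _; rewrite !subSS !subn0.
  rewrite [in RHS]altn; last by case: (n) n4 => [|[|[|[|k]]]] // _; rewrite !subSS subn0.
  by rewrite oddB ?(ltnW n4) // n_odd addbT negbK.
have flips j : C j.*2 2 = C 0 2 (+) odd j.
  by elim: j => [|j IHj]; rewrite ?addbF // doubleS flip IHj /= addbN.
(* Going round twice makes [n] steps of length 2, hence an odd number of flips, and ends at the
   starting edge. *)
have := flips n; rewrite n_odd addbT -addnn /C.
have w2 i : w (i + (n + n)) = w i by rewrite addnA !wn.
rewrite -[X in c [set w X; _]]add0n w2 addnC w2.
by case: (c _).
Qed.

Lemma no_mono_cobipartite : indep3_free G -> cobipartite G.
Proof.
move=> GI; have [//|[n [w [n_odd wn]]]] := bipartite_or_odd_walk (@compl_sym G).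
by case: (no_odd_closed_walk GI n_odd wn).
Qed.

End NoMonochromaticPath.

Lemma elementaryE G : elementary G <-> exists c : colouring G, no_mono_P3 c.
Proof.
have E (c : colouring G) : no_mono_P3 c <->
    forall S : {set G}, giso (induced S) (path_graph 3) ->
      ~ monochromatic (@cinduced (CGraph c) S).
  have [F1 F2] := free_members [:: Path red; Path blue] (CGraph c).
  split=> [cP S [f f_bij fA] [k mono]|H].
    have cF : free (members (map pgraph [:: Path red; Path blue])) (CGraph c).
      apply: F2 => p [<-|[<-|[]]] x y z [/cP + E1 E2]; by rewrite /= in E1 E2; rewrite E1 E2.
    apply: (cF S (pgraph (Path k))).
      by case: k {mono} => /=; [left|right; left].
    have iso : ciso (@cinduced (CGraph c) S) (monocol k (path_graph 3)).
      exists f; split=> // x y xy; rewrite mono //.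
      by apply/imsetP; exists (x, y).
    by case: k {mono} iso.
  move=> x y z xyz E.
  pose k := c [set x; y].
  have /F1/(_ (Path k)) : free (members (map pgraph [:: Path red; Path blue])) (CGraph c).
    move=> S P PF [f [f_bij fA fC]].
    have [l PE] : exists l, P = monocol l (path_graph 3).
      by case: PF => [<-|[<-|[]]]; [exists red | exists blue].
    subst P; apply: (H S); first by exists f.
    exists l => e /imsetP[[u v]]; rewrite inE => uv ->.
    by rewrite -(fC _ _ uv).
  apply; first by case: (k); [left | right; left].
  by split; [exact: xyz | by [] | rewrite /= -E].
by split=> -[c cE]; exists c; apply/E.
Qed.

(** Edges inside a side get [other k], edges across get [k]. The ends of an induced path lie on
    different sides, so exactly one of its edges crosses; in a complement of $P_3$ the isolated
    vertex forces both ends of the edge onto the opposite side. *)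
Lemma cobipartite_colouring G k : cobipartite G ->
  exists c : colouring G, no_mono_P3 c /\
    forall x y z, coP3 x y z -> c [set x; z] = other k.
Proof.
case=> f fE; have fA (x y : G) : x != y -> ~~ adj x y -> f x != f y.
  by move=> xy nxy; apply: fE; rewrite /= /compl_adj xy.
have [|c cE] := @colouring_exists G (other k) (fun x y => f x == f y).
  by move=> x y; apply: eq_sym.
exists c; split=> x y z.
  case/and4P=> xz _ _ nxz; rewrite !cE; have := fA _ _ xz nxz.
  by case: (f x); case: (f y); case: (f z) => //; case: (k).
move=> xyz; have := coP3_uniq xyz; rewrite /= !inE negb_or andbT.
case/andP=> /andP[xy _] yz; case/and3P: xyz => nxy nyz _; rewrite cE.
have := fA _ _ xy nxy; have := fA _ _ yz nyz.
by case: (f x); case: (f y); case: (f z).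
Qed.

Lemma cobipartite_indep3 G : cobipartite G -> indep3_free G.
Proof.
case=> f fE; apply: (@indep3_pigeon G bool f); first by rewrite card_bool.
move=> x y xy fxy; apply: contraT => nxy.
by have := fE x y; rewrite /= /compl_adj xy nxy fxy eqxx => /(_ isT).
Qed.

Lemma edgeless_completeE G :
  class_union edgeless complete G <-> P3_free G /\ coP3_free G.
Proof.
split=> [[GE|GC]|[GP GQ]].
- by split=> x y z; rewrite /P3 /coP3 !(negPf (GE _ _)) ?andbF.
- split=> x y z; apply/negP.
    by case/and4P=> xz _ _; rewrite GC.
  move=> A; have := coP3_uniq A; rewrite /= inE negb_or => /andP[/andP[xy _] _].
  by case/and3P: A; rewrite GC.
have [GE|/not_all_ex_not[a /not_all_ex_not[b /negP]]] := classic (edgeless G).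
  by left.
rewrite negbK => ab; right=> x y xy.
(* A vertex not adjacent to [a] would form with the edge [a b] an induced path or a complement of
   one. *)
have aA z : z != a -> adj a z.
  move=> za; apply: contraT => naz; have := GQ a z b; have := GP a b z.
  rewrite /coP3 /P3 ab naz /= andbT eq_sym za /= => nbz.
  by rewrite adj_sym nbz.
have [E|xa] := eqVneq x a; first by subst x; rewrite aA // eq_sym.
have [E|ya] := eqVneq y a; first by subst y; rewrite adj_sym aA.
apply: contraT => nxy; have := GP x a y.
by rewrite /P3 xy adj_sym !aA ?nxy.
Qed.

Lemma edgeless_coP3 G : edgeless G -> coP3_free G.
Proof. by move=> GE; case/edgeless_completeE: (or_introl GE : class_union edgeless complete G). Qed.

Lemma edgeless_P3 G : edgeless G -> P3_free G.
Proof. by move=> GE; case/edgeless_completeE: (or_introl GE : class_union edgeless complete G). Qed.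

Lemma complete_minus_matching_cobipartite G :
  complete_minus_matching G -> cobipartite G.
Proof.
move=> /complete_minus_matchingE[GQ GI].
(* The complement is a matching; [f] marks the end of smaller rank of each of its edges. *)
pose f (x : G) := [exists y, compl_adj x y && (enum_rank x < enum_rank y)].
have two (x y z : G) : compl_adj x y -> compl_adj x z -> y = z.
  move=> /andP[xy nxy] /andP[xz nxz]; apply/eqP; apply: contraT => yz.
  case yAz: (adj y z).
    by have := GQ y x z; rewrite /coP3 adj_sym nxy nxz yAz.
  by have := GI y x z; rewrite /indep3 adj_sym nxy nxz yAz yz eq_sym xy xz.
have fE (x y : G) : compl_adj x y -> f x = (enum_rank x < enum_rank y).
  move=> xy; apply/existsP/idP => [[z /andP[xz]]|lt]; last by exists y; rewrite xy.
  by rewrite (two _ _ _ xy xz).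
exists f => x y xy; rewrite (fE x y) // (fE y x); last by rewrite compl_sym.
have /andP[/negPf ne _] := xy.
by case: ltngtP => // /val_inj/enum_rank_inj E; rewrite E eqxx in ne.
Qed.

(** * Separating the pattern without edges *)

Definition expresses_up_to_K3 (s : pattern -> Prop) (D : sgraph -> Prop) :=
  forall G, D G <-> exists c : colouring G,
    forall p, p <> K3 -> s p -> avoids p (CGraph c).

Definition expresses_pat (s : pattern -> Prop) (D : sgraph -> Prop) :=
  forall G, D G <-> exists c : colouring G,
    forall p, s p -> avoids p (CGraph c).

Lemma expresses_no_K3 s D :
  ~ s K3 -> expresses_up_to_K3 s D -> expresses_pat s D.
Proof.
move=> sK sD G; rewrite sD; split=> -[c cA]; exists c => p; last by move=> _; apply: cA.
by move=> sp; apply: cA => // E; apply: sK; rewrite -E.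
Qed.

(** [K3] does not see the colouring, so its avoidance moves out of the existential quantifier, and
    each colouring argument serves two pattern sets. *)
Lemma expresses_K3 s (D D' : sgraph -> Prop) :
  s K3 -> (forall G, D' G <-> D G /\ indep3_free G) ->
  expresses_up_to_K3 s D -> expresses_pat s D'.
Proof.
move=> sK DD' sD G; rewrite DD' sD; split=> [[[c cA] GI]|[c cA]].
  exists c => p; case E: p => [|k|k|] sp; last by apply: cA.
  - by move=> x y z; apply/negP; apply: GI.
  - exact: cA.
  - exact: cA.
split; first by exists c => p _; apply: cA.
by move=> x y z; apply/negP; apply: (cA K3 sK).
Qed.

Lemma expresses_members l D :
  expresses_pat (fun p => List.In p l) D ->
  expresses (members (map pgraph l)) D.
Proof.
by move=> lD G; rewrite lD; split=> -[c cA]; exists c; apply/free_members.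
Qed.

(** * Pattern sets and the classes they express *)

Section Expressing.
Variable s : pattern -> Prop.

Section Avoiding.
Variables (G : sgraph) (c : colouring G).

Lemma avoidsP : (forall p, p <> K3 -> s p -> avoids p (CGraph c)) <->
  [/\ forall k x y z, s (Edge k) -> coP3 x y z -> c [set x; z] <> k,
      forall k x y z, s (Path k) -> P3 x y z -> c [set x; y] = k ->
        c [set y; z] <> k
    & forall x y z, s MixedPath -> P3 x y z -> c [set x; y] = c [set y; z]].
Proof.
split=> [cA|[cE cP cM] p].
  split=> [k x y z sk xyz E|k x y z sk xyz E1 E2|x y z sM xyz].
  - by apply: (cA (Edge k)) => //; split; [exact: xyz|].
  - by apply: (cA (Path k)) => //; split; [exact: xyz| |].
  case E1: (c _); case E2: (c _) => //.
    by case: (cA MixedPath _ sM x y z).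
  (* Reversing the path covers the other order of colours, which is why the condition becomes a
     plain equality. *)
  case: (cA MixedPath _ sM z y x) => //; split; first by rewrite P3C.
    by rewrite setUC.
  by rewrite setUC.
case: p => [|k|k|] // _ sp x y z.
- by case=> xyz; apply: (cE k x y z).
- by case=> xyz; apply: (cP k x y z).
- by case=> xyz E1 E2; have := cM _ _ _ sp xyz; rewrite [LHS]E1 [RHS]E2.
Qed.

End Avoiding.

Lemma avoids_const G k : (s (Edge k) -> coP3_free G) ->
  (s (Path k) -> P3_free G) ->
  exists c : colouring G, forall p, p <> K3 -> s p -> avoids p (CGraph c).
Proof.
move=> GQ GP; exists (fun=> k); apply/avoidsP; split=> //.
  by move=> l x y z sl xyz E; subst l; move: xyz; apply/negP; apply: GQ.
by move=> l x y z sl xyz E; subst l; case/negP: (GP sl x y z).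
Qed.

Lemma no_monoP G (c : colouring G) : (forall k, s (Path k)) ->
  (forall p, p <> K3 -> s p -> avoids p (CGraph c)) -> no_mono_P3 c.
Proof.
by move=> sP /avoidsP[_ cP _] x y z xyz E; case: (cP _ _ _ _ (sP _) xyz erefl).
Qed.

Lemma avoids_P3_free G (c : colouring G) : (forall k, s (Path k)) ->
  s MixedPath -> (forall p, p <> K3 -> s p -> avoids p (CGraph c)) -> P3_free G.
Proof.
move=> sP sM cA x y z; apply/negP=> xyz; have cP := no_monoP sP cA xyz.
by case/avoidsP: cA => _ _ cM; apply: cP; apply: cM.
Qed.

Lemma avoids_coP3_free G (c : colouring G) : (forall k, s (Edge k)) ->
  (forall p, p <> K3 -> s p -> avoids p (CGraph c)) -> coP3_free G.
Proof.
move=> sE /avoidsP[cE _ _] x y z; apply/negP => xyz.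
by case: (cE _ _ _ _ (sE _) xyz erefl).
Qed.

Lemma expresses_all k : ~ s (Edge k) -> ~ s (Path k) ->
  expresses_up_to_K3 s all_graphs.
Proof. by move=> sE sP G; split=> // _; apply: (avoids_const (k := k)). Qed.

Lemma expresses_complete_multipartite k : (forall l, s (Edge l)) ->
  ~ s (Path k) -> expresses_up_to_K3 s complete_multipartite.
Proof.
move=> sE sP G; rewrite complete_multipartiteE; split=> [GQ|[c]].
  exact: (avoids_const (k := k)).
exact: avoids_coP3_free.
Qed.

Lemma expresses_cluster k : ~ s (Edge k) -> (forall l, s (Path l)) ->
  s MixedPath -> expresses_up_to_K3 s cluster.
Proof.
move=> sE sP sM G; rewrite clusterE; split=> [GP|[c]].
  exact: (avoids_const (k := k)).
exact: avoids_P3_free.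
Qed.

Lemma expresses_edgeless_complete : (forall l, s (Edge l)) ->
  (forall l, s (Path l)) -> s MixedPath ->
  expresses_up_to_K3 s (class_union edgeless complete).
Proof.
move=> sE sP sM G; rewrite edgeless_completeE; split=> [[GP GQ]|[c cA]].
  exact: (avoids_const (k := red)).
by split; [exact: avoids_P3_free cA | exact: avoids_coP3_free cA].
Qed.

Lemma expresses_elementary : (forall l, ~ s (Edge l)) ->
  (forall l, s (Path l)) -> ~ s MixedPath ->
  expresses_up_to_K3 s elementary.
Proof.
move=> sE sP sM G; rewrite elementaryE; split=> -[c cA]; exists c.
  apply/avoidsP; split=> [k x y z /sE//|k x y z _ /cA + E|//].
  by rewrite E => H /esym.
exact: no_monoP.
Qed.

Lemma expresses_edgeless_matching : (forall l, s (Edge l)) ->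
  (forall l, s (Path l)) -> ~ s MixedPath ->
  expresses_up_to_K3 s (class_union edgeless complete_minus_matching).
Proof.
move=> sE sP sM G; split=> [[GE|GM]|[c cA]].
- apply: (avoids_const (k := red)) => _; first exact: edgeless_coP3.
  exact: edgeless_P3.
- have [c [cP _]] := cobipartite_colouring red (complete_minus_matching_cobipartite GM).
  have [GQ _] := (complete_minus_matchingE G).1 GM.
  exists c; apply/avoidsP; split=> [k x y z _|k x y z _ /cP + E|//].
    by rewrite (negPf (GQ x y z)).
  by rewrite E => H /esym.
have GQ := avoids_coP3_free sE cA; have cP := no_monoP sP cA.
have [GE|/not_all_ex_not[a /not_all_ex_not[b /negP]]] := classic (edgeless G).
  by left.
rewrite negbK => ab; right; apply/complete_minus_matchingE; split=> //.
move=> x y z; apply/negP=> xyz.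
(* Non-adjacent vertices have the same neighbours. Hence a neighbour [d] of one vertex of an
   independent triple is adjacent to all three, which gives a forbidden claw; an edge [a b] provides
   such a [d]. *)
have spread (u v w : G) : adj u v -> ~~ adj v w -> adj u w.
  move=> uv vw; have := GQ u w v.
  by rewrite /coP3 uv (adj_sym w v) vw !andbT negbK.
have [d dx] : exists d : G, adj d x.
  case xa: (adj a x); first by exists a.
  by exists b; apply: (spread b a x); rewrite ?xa // adj_sym.
have /and5P[_ _ _ nxy /andP[_ nxz]] := xyz.
by apply: (no_mono_claw cP xyz dx); apply: spread dx _.
Qed.

(** When [Edge k] is forbidden, the colour [other k] is compulsory on edges with a common
    non-neighbour. Using it nowhere else is the most economical choice, and each use comes with a
    witness. *)
Lemma witness_colouring G k : exists c : colouring G,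
  (forall x y z, coP3 x y z -> c [set x; z] = other k) /\
  (forall x y, c [set x; y] <> k -> exists2 z, ~~ adj z x & ~~ adj z y).
Proof.
pose q (x y : G) := [exists z, ~~ adj z x && ~~ adj z y].
have [|c cE] := @colouring_exists G (other k) q.
  by move=> x y; apply: eq_existsb => z; rewrite andbC.
exists c; split=> [x y z /and3P[nxy nyz _]|x y].
  rewrite cE; case: ifP => // /existsPn/(_ y).
  by rewrite adj_sym nxy nyz.
rewrite cE; case: ifP => [/existsP[z /andP[zx zy]]|_]; first by exists z.
by case: k {cE}.
Qed.

Lemma expresses_K1P3_C5 k : s (Edge k) -> s (Path (other k)) ->
  ~ s (Edge (other k)) -> ~ s (Path k) -> ~ s MixedPath ->
  expresses_up_to_K3 s
    (gfree (members [:: disjoint_union (edgeless_graph 1) (path_graph 3);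
                        cycle_graph 5])).
Proof.
move=> sE sP sE' sP' sM G; rewrite gfree_K1P3_C5E.
split=> [[GK GC]|[c /avoidsP[cE cP _]]].
  have [c [cQ cW]] := witness_colouring G k; exists c; apply/avoidsP.
  split=> [l x y z sl /cQ -> E|l x y z sl xyz E1 E2|//].
    by case: sE'; rewrite E.
  have {sl} lk : l <> k by move=> E; apply: sP'; rewrite -E.
  (* The witnesses [u] of [x y] and [v] of [y z] must see [z] and [x] respectively, by
     $K_1+P_3$-freeness. If they are adjacent, [x y z u v] is a $C_5$; if not, [u] and the path
     [v x y] form $K_1+P_3$. *)
  have [|u nux nuy] := cW x y; first by rewrite E1.
  have [|v nvy nvz] := cW y z; first by rewrite E2.
  case/and4P: (xyz) => xz xy yz nxz.
  have uy : u != y by apply: contraNneq nux => ->; rewrite adj_sym.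
  have vy : v != y by apply: contraNneq nvz => ->.
  have uz : adj u z.
    by apply: contraT => nuz; have := GK u x y z; rewrite /K1P3 xyz uy nux nuy nuz.
  have vx : adj v x.
    by apply: contraT => nvx; have := GK v x y z; rewrite /K1P3 xyz vy nvx nvy nvz.
  have [uv|nuv] := boolP (adj u v).
    have := GC x y z u v.
    rewrite /C5 xy yz (adj_sym z u) uz uv vx nxz (adj_sym y u) nuy.
    by rewrite (adj_sym z v) nvz nux nvy.
  have uNx : u != x by apply: contraNneq nuy => ->.
  have uNv : u != v by apply: contraNneq nux => ->.
  have := GK u v x y; rewrite /K1P3 /P3 vy vx xy nvy uNx nuv nux nuy.
  by [].
(* Colours are forced here: the path of $K_1+P_3$ has the isolated vertex as common non-neighbour,
   and each edge of a $C_5$ has the opposite vertex. *)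
have cR a b w : adj a b -> ~~ adj w a -> ~~ adj w b -> c [set a; b] = other k.
  move=> ab wa wb; apply: otherP; apply: (cE k a w b) => //.
  by rewrite /coP3 adj_sym wa wb.
split=> [u x y z|a b d e f]; apply/negP.
  case/and5P=> xyz _ nux nuy nuz; case/and4P: (xyz) => _ xy yz _.
  by case: (cP _ _ _ _ sP xyz (cR _ _ u xy nux nuy)); apply: (cR _ _ u).
move=> abdef; have := C5_uniq abdef; rewrite /= !inE !negb_or.
case/andP=> /and4P[_ ad _ _] _.
case/andP: abdef => /and5P[ab bd de ef fa] /and5P[nad nbe ndf nea nfb].
have abd : P3 a b d by rewrite /P3 ad ab bd nad.
case: (cP _ _ _ _ sP abd); first by apply: (cR _ _ e ab nea); rewrite adj_sym.
by apply: (cR _ _ f bd nfb); rewrite adj_sym.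
Qed.

(** The join condition says that an edge of an induced path has no common non-neighbour, so the
    witness colouring gives it [k]. Conversely, a common non-neighbour forces [other k] on one edge,
    and the forbidden mixed path carries this colour to the other edge. *)
Lemma expresses_join_of_cluster k : s (Edge k) -> s (Path (other k)) ->
  ~ s (Edge (other k)) -> ~ s (Path k) -> s MixedPath ->
  expresses_up_to_K3 s (join_of cluster).
Proof.
move=> sE sP sE' sP' sM G; rewrite join_of_clusterE.
split=> [GJ|[c /avoidsP[cE cP cM]] x y z u xyz uy nuy].
  have [c [cQ cW]] := witness_colouring G k; exists c.
  have ck x y z : P3 x y z -> c [set x; y] = k.
    move=> xyz; apply: NNPP => /cW[u nux nuy].
    case/negP: (nux); apply: (GJ _ _ _ _ xyz) => //.
    case/and4P: xyz => _ xy _ _.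
    by apply: contraNneq nux => ->; rewrite adj_sym.
  apply/avoidsP; split=> [l x y z sl /cQ -> E|l x y z sl /ck-> E|x y z _ xyz].
  - by case: sE'; rewrite E.
  - by case: sP'; rewrite E.
  - by rewrite (ck _ _ _ xyz) setUC (ck z y x) // P3C.
apply: contraT => nux; case/and4P: (xyz) => _ xy _ _.
have cxy : c [set x; y] = other k.
  apply: otherP; apply: (cE k x u y) => //.
  by rewrite /coP3 adj_sym nux nuy.
case: (cP _ _ _ _ sP xyz cxy).
by rewrite -(cM _ _ _ sM xyz).
Qed.

Lemma expresses_cobipartite_cluster k : s (Edge k) -> ~ s (Edge (other k)) ->
  (forall l, s (Path l)) -> ~ s MixedPath ->
  expresses_up_to_K3 s (class_union cobipartite cluster).
Proof.
move=> sE sE' sP sM G; split=> [[GB|/clusterE GP]|[c cA]].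
- have [c [cP cQ]] := cobipartite_colouring k GB.
  exists c; apply/avoidsP; split=> [l x y z sl /cQ -> E|l x y z _ /cP + E|//].
    by apply: sE'; rewrite E.
  by rewrite E => H /esym.
- exact: (avoids_const (k := other k)).
have cP := no_monoP sP cA; case/avoidsP: cA => cE _ _.
have [GI|] := classic (indep3_free G).
  by left; apply: no_mono_cobipartite cP GI.
move=> /not_all_ex_not[a0 /not_all_ex_not[b0 /not_all_ex_not[d0 /negP]]].
rewrite negbK => abd; right; apply/clusterE.
have claw := no_mono_claw cP.
(* Every vertex sees an end of an edge coloured [k]. *)
have cQ x y w : adj x y -> c [set x; y] = k -> adj w x || adj w y.
  move=> xy ck; apply: contraT; rewrite negb_or => /andP[wx wy].
  by case: (cE k x w y sE); rewrite // /coP3 adj_sym wx wy.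
have swap (x y z : G) : indep3 x y z -> indep3 y x z.
  case/and5P=> xy yz xz nxy /andP[nyz nxz].
  by rewrite /indep3 xz yz nxz nyz eq_sym xy adj_sym nxy.
have rot (x y z : G) : indep3 x y z -> indep3 y z x.
  case/and5P=> xy yz xz nxy /andP[nyz nxz].
  by rewrite /indep3 yz nyz !(eq_sym _ x) xy xz !(adj_sym _ x) nxy nxz.
(* The path [a x y] forces the colour of [a x] away from [k], then [a x b] forces [b x] to be [k];
   but [d] sees neither [b] nor [x]. *)
have two (x y a b d : G) : adj x y -> c [set x; y] = k -> indep3 a b d ->
    adj a x -> adj b x -> ~~ adj d x -> ~~ adj a y -> False.
  move=> xy ck ind ax bx ndx nay; have := cQ x y d xy ck.
  rewrite (negPf ndx) /= => dy; have /and5P[ab _ _ nab /andP[nbd nad]] := ind.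
  have axy : P3 a x y.
    rewrite /P3 ax xy nay !andbT; apply: contraNneq nad => ->.
    by rewrite adj_sym.
  have axb : P3 a x b by rewrite /P3 ab ax nab adj_sym bx.
  have cbx : c [set b; x] = k.
    have := cP _ _ _ axy; have := cP _ _ _ axb.
    by rewrite ck (setUC [set b]); case: (c _); case: (c _); case: (k).
  by have := cQ b x d bx cbx; rewrite (negPf ndx) adj_sym (negPf nbd).
(* Since [d] misses [x], it sees [y]; as there is no claw at [y], one of [a] and [b] misses [y]. The
   configuration of [two] then appears up to relabelling. *)
have one (x y a b d : G) : adj x y -> c [set x; y] = k -> indep3 a b d ->
    ~~ adj d x -> False.
  move=> xy ck ind ndx; have cov := cQ x y _ xy ck.
  have yx : adj y x by rewrite adj_sym.
  have ck' : c [set y; x] = k by rewrite setUC.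
  have dy : adj d y by have := cov d; rewrite (negPf ndx).
  have clawy : ~~ (adj a y && adj b y).
    apply/negP=> /andP[ay by']; apply: (claw y _ _ _ ind); by rewrite adj_sym.
  have [ax|nax] := boolP (adj a x); last first.
    have ay : adj a y by have := cov a; rewrite (negPf nax).
    rewrite ay /= in clawy.
    by apply: (two y x a d b) => //; exact: (swap _ _ _ (rot _ _ _ (rot _ _ _ ind))).
  have [bx|nbx] := boolP (adj b x); last first.
    have by' : adj b y by have := cov b; rewrite (negPf nbx).
    rewrite by' andbT in clawy.
    by apply: (two y x b d a) => //; exact: (rot _ _ _ ind).
  have [ay|nay] := boolP (adj a y); last exact: (two x y a b d).
  by rewrite ay /= in clawy; apply: (two x y b a d) => //; apply: swap.
(* The triple cannot be entirely adjacent to [x], again by the claw, so one of its vertices misses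
   [x]. *)
have colk (x y : G) : adj x y -> c [set x; y] <> k.
  move=> xy ck.
  have [ax|nax] := boolP (adj a0 x); last first.
    by apply: (one x y b0 d0 a0) => //; exact: (rot _ _ _ abd).
  have [bx|nbx] := boolP (adj b0 x); last first.
    by apply: (one x y d0 a0 b0) => //; exact: (rot _ _ _ (rot _ _ _ abd)).
  have [dx|ndx] := boolP (adj d0 x); last exact: (one x y a0 b0 d0).
  by apply: (claw x _ _ _ abd); rewrite adj_sym.
move=> x y z; apply/negP=> xyz; case/and4P: (xyz) => _ xy yz _.
by have := cP _ _ _ xyz; rewrite (otherP (colk _ _ xy)) (otherP (colk _ _ yz)).
Qed.

End Expressing.

(** * The classification *)

Definition classes : seq (sgraph -> Prop) :=
  [:: all_graphs;
      complete_multipartite;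
      cluster;
      gfree (members [:: edgeless_graph 3]);
      complete_minus_matching;
      class_union edgeless complete;
      cluster_le2;
      class_union complete (fun G => giso G (edgeless_graph 2));
      class_union edgeless complete_minus_matching;
      gfree (members [:: disjoint_union (edgeless_graph 1) (path_graph 3);
                         cycle_graph 5]);
      gfree (members [:: edgeless_graph 3; cycle_graph 5]);
      join_of cluster;
      join_of cluster_le2;
      class_union cobipartite cluster;
      cobipartite;
      elementary].

Lemma cluster_le2_K3 G : cluster_le2 G <-> cluster G /\ indep3_free G.
Proof. by rewrite cluster_le2E clusterE. Qed.

Lemma complete_minus_matching_K3 G :
  complete_minus_matching G <-> complete_multipartite G /\ indep3_free G.
Proof. by rewrite complete_minus_matchingE complete_multipartiteE. Qed.

Lemma gfree_edgeless3_K3 G :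
  gfree (members [:: edgeless_graph 3]) G <-> all_graphs G /\ indep3_free G.
Proof. by rewrite gfree_edgeless3E; split=> [|[]]. Qed.

Lemma edgeless_matching_K3 G : complete_minus_matching G <->
  class_union edgeless complete_minus_matching G /\ indep3_free G.
Proof.
split=> [GM|[[GE|//] GI]].
  by split; [right | case/complete_minus_matchingE: GM].
by apply/complete_minus_matchingE; split=> //; apply: edgeless_coP3.
Qed.

(** An edgeless graph without independent triples has at most two vertices, and with fewer than two
    it is complete. *)
Lemma complete_edgeless2_K3 G :
  class_union complete (fun G => giso G (edgeless_graph 2)) G <->
  class_union edgeless complete G /\ indep3_free G.
Proof.
split=> [[GC|[f /bij_inj f_inj fA]]|[[GE|GC] GI]].
- split; first by right.
  by move=> x y z; apply/negP=> /and5P[xy _ _]; rewrite GC.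
- split; first by left=> x y; rewrite -fA.
  have f2 : #|'I_2| <= 2 by rewrite card_ord.
  by apply: (indep3_pigeon (f := f) f2) => x y xy /f_inj E; rewrite E eqxx in xy.
- have G2 : #|G| <= 2.
    rewrite leqNgt; apply/negP=> /card_gt2P[x [y [z [_ [xy yz zx]]]]].
    by have := GI x y z; rewrite /indep3 xy yz eq_sym zx !GE.
  have [E|ne] := eqVneq #|G| 2.
    right; exists (fun x => cast_ord E (enum_rank x)).
      apply: inj_card_bij; last by rewrite card_ord E.
      exact: inj_comp (@cast_ord_inj _ _ _) enum_rank_inj.
    by move=> x y; rewrite (negPf (GE x y)).
  left=> x y xy; have : #|G| <= 1 by rewrite -ltnS ltn_neqAle ne.
  by move/fintype_le1P => /(_ x y) E; rewrite E eqxx in xy.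
- by left.
Qed.

Lemma cobipartite_cluster_K3 G :
  cobipartite G <-> class_union cobipartite cluster G /\ indep3_free G.
Proof.
split=> [GB|[[//|/clusterE GP] GI]].
  by split; [left | exact: cobipartite_indep3].
(* In a cluster there is no induced path, so even the constant colouring qualifies. *)
apply: (@no_mono_cobipartite _ (fun=> red)) GI => x y z.
by rewrite (negPf (GP x y z)).
Qed.

Lemma elementary_K3 G : cobipartite G <-> elementary G /\ indep3_free G.
Proof.
split=> [GB|[/elementaryE[c cP] GI]]; last exact: no_mono_cobipartite cP GI.
split; last exact: cobipartite_indep3.
by have [c [cP _]] := cobipartite_colouring red GB; apply/elementaryE; exists c.
Qed.

Ltac in_classes := by do ![by left | right].

Lemma classification_up_to_K3 (s : pattern -> Prop) : exists D D',
  [/\ List.In D classes, List.In D' classes, expresses_up_to_K3 s D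
    & forall G, D' G <-> D G /\ indep3_free G].
Proof.
have [[k [sE sP]]|none] := classic (exists k, ~ s (Edge k) /\ ~ s (Path k)).
  exists all_graphs, (gfree (members [:: edgeless_graph 3])).
  split; [in_classes | in_classes | exact: (expresses_all sE sP) |].
  exact: gfree_edgeless3_K3.
(* From here on, each colour has its one-edge pattern or its path in [s]. *)
have sEP k : ~ s (Edge k) -> s (Path k).
  by move=> sE; apply: NNPP => sP; apply: none; exists k.
have [sE|/not_all_ex_not[k sEk]] := classic (forall k, s (Edge k)).
  have [sP|/not_all_ex_not[k sPk]] := classic (forall k, s (Path k)); last first.
    exists complete_multipartite, complete_minus_matching.
    split; [in_classes | in_classes | exact: (expresses_complete_multipartite sE sPk) |].
    exact: complete_minus_matching_K3.
  have [sM|sM] := classic (s MixedPath).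
    exists (class_union edgeless complete).
    exists (class_union complete (fun G => giso G (edgeless_graph 2))).
    split; [in_classes | in_classes | exact: (expresses_edgeless_complete sE sP sM) |].
    exact: complete_edgeless2_K3.
  exists (class_union edgeless complete_minus_matching), complete_minus_matching.
  split; [in_classes | in_classes | exact: (expresses_edgeless_matching sE sP sM) |].
  exact: edgeless_matching_K3.
have [sP|notP] := classic (forall l, s (Path l)).
  have [sM|sM] := classic (s MixedPath).
    exists cluster, cluster_le2.
    split; [in_classes | in_classes | exact: (expresses_cluster sEk sP sM) |].
    exact: cluster_le2_K3.
  have [sEo|sEo] := classic (s (Edge (other k))).
    exists (class_union cobipartite cluster), cobipartite.
    split; [in_classes | in_classes | | exact: cobipartite_cluster_K3].
    by apply: (expresses_cobipartite_cluster sEo) => //; case: k sEk {sEo}.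
  exists elementary, cobipartite.
  split; [in_classes | in_classes | | exact: elementary_K3].
  by apply: expresses_elementary => // -[]; case: k sEk sEo.
have sPk : s (Path k) := sEP k sEk.
have sPo : ~ s (Path (other k)).
  by move=> sPo; apply: notP => -[]; case: k sEk sPk sPo.
have sEo : s (Edge (other k)) by apply: NNPP => /sEP.
(* The roles are turned round: the forbidden one-edge pattern has colour [other k], so the colour
   [k] of the path must be displayed as its opposite. *)
have ook : other (other k) = k by case: (k).
rewrite -{1}ook in sPk; rewrite -{1}ook in sEk.
have [sM|sM] := classic (s MixedPath).
  exists (join_of cluster), (join_of cluster_le2).
  split; [in_classes | in_classes | | exact: join_of_cluster_le2E].
  exact: expresses_join_of_cluster sEo sPk sEk sPo sM.
eexists; exists (gfree (members [:: edgeless_graph 3; cycle_graph 5])).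
split; last exact: gfree_edgeless3_C5E; [in_classes | in_classes |].
exact: expresses_K1P3_C5 sEo sPk sEk sPo sM.
Qed.

Lemma classification (s : pattern -> Prop) :
  exists2 D, List.In D classes & expresses_pat s D.
Proof.
have [D [D' [DC D'C sD DD']]] := classification_up_to_K3 s.
have [sK|sK] := classic (s K3).
  by exists D' => //; apply: expresses_K3 sK DD' sD.
by exists D => //; apply: expresses_no_K3.
Qed.

Lemma members_no_K3 l D : ~ List.In K3 l ->
  expresses_up_to_K3 (fun p => List.In p l) D ->
  expresses (members (map pgraph l)) D.
Proof. by move=> lK lD; apply: expresses_members; apply: expresses_no_K3. Qed.

Lemma members_K3 l (D D' : sgraph -> Prop) :
  (forall G, D' G <-> D G /\ indep3_free G) ->
  expresses_up_to_K3 (fun p => List.In p (K3 :: l)) D ->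
  expresses (members (map pgraph (K3 :: l))) D'.
Proof.
move=> DD' lD; apply: expresses_members; apply: expresses_K3 DD' lD.
by left.
Qed.

Ltac decide_In := try (case=> //); simpl; intuition congruence.

Theorem theorem32 :
  (forall C : sgraph -> Prop,
    (exists F : cgraph -> Prop,
       (forall P, F P -> three_vertices_le2_edges P) /\ expresses F C)
    <->
    (exists D : sgraph -> Prop,
       List.In D
         [:: all_graphs;
             complete_multipartite;
             cluster;
             gfree (members [:: edgeless_graph 3]);
             complete_minus_matching;
             class_union edgeless complete;
             cluster_le2;
             class_union complete (fun G => giso G (edgeless_graph 2));
             class_union edgeless complete_minus_matching;
             gfree (members [:: disjoint_union (edgeless_graph 1) (path_graph 3);
                                cycle_graph 5]);
             gfree (members [:: edgeless_graph 3; cycle_graph 5]);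
             join_of cluster;
             join_of cluster_le2;
             class_union cobipartite cluster;
             cobipartite;
             elementary]
       /\ (forall G, C G <-> D G)))
  /\ expresses (members [:: P_rcoP3]) all_graphs
  /\ expresses (members [:: P_rP3; P_bP3; P_rbP3]) cluster
  /\ expresses (members [:: P_3K1]) (gfree (members [:: edgeless_graph 3]))
  /\ expresses (members [:: P_3K1; P_rcoP3; P_bcoP3]) complete_minus_matching
  /\ expresses (members [:: P_rcoP3; P_bcoP3; P_rP3; P_bP3; P_rbP3])
       (class_union edgeless complete)
  /\ expresses (members [:: P_3K1; P_rP3; P_bP3; P_rbP3]) cluster_le2
  /\ expresses (members [:: P_3K1; P_rcoP3; P_bcoP3; P_rP3; P_bP3; P_rbP3])
       (class_union complete (fun G => giso G (edgeless_graph 2)))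
  /\ expresses (members [:: P_rcoP3; P_bcoP3; P_rP3; P_bP3])
       (class_union edgeless complete_minus_matching)
  /\ expresses (members [:: P_bcoP3; P_rP3])
       (gfree (members [:: disjoint_union (edgeless_graph 1) (path_graph 3);
                           cycle_graph 5]))
  /\ expresses (members [:: P_3K1; P_bcoP3; P_rP3])
       (gfree (members [:: edgeless_graph 3; cycle_graph 5]))
  /\ expresses (members [:: P_bcoP3; P_rP3; P_rbP3]) (join_of cluster)
  /\ expresses (members [:: P_3K1; P_bcoP3; P_rP3; P_rbP3])
       (join_of cluster_le2)
  /\ expresses (members [:: P_bcoP3; P_rP3; P_bP3])
       (class_union cobipartite cluster)
  /\ expresses (members [:: P_3K1; P_rP3; P_bP3]) cobipartite
  /\ expresses (members [:: P_rP3; P_bP3]) elementary.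

Proof.
have members3 l P : members (map pgraph l) P -> three_vertices_le2_edges P.
  by move=> /List.in_map_iff[p [<- _]]; apply: pgraph_le2.
have e_all : expresses (members (map pgraph [:: Edge red])) all_graphs.
  by apply: members_no_K3; [decide_In | apply: (expresses_all (k := blue)); decide_In].
(* Complete multipartite graphs come with no set in the statement, but the converse direction needs
   one. *)
have e_mult : expresses (members (map pgraph [:: Edge red; Edge blue]))
    complete_multipartite.
  apply: members_no_K3; first by decide_In.
  by apply: (expresses_complete_multipartite (k := red)); decide_In.
have e_cluster : expresses
    (members (map pgraph [:: Path red; Path blue; MixedPath])) cluster.
  apply: members_no_K3; first by decide_In.
  by apply: (expresses_cluster (k := red)); decide_In.
have e_K3 : expresses (members (map pgraph [:: K3]))
    (gfree (members [:: edgeless_graph 3])).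
  apply: (members_K3 gfree_edgeless3_K3).
  by apply: (expresses_all (k := red)); decide_In.
have e_cmm : expresses (members (map pgraph [:: K3; Edge red; Edge blue]))
    complete_minus_matching.
  apply: (members_K3 complete_minus_matching_K3).
  by apply: (expresses_complete_multipartite (k := red)); decide_In.
have e_ec : expresses (members (map pgraph
    [:: Edge red; Edge blue; Path red; Path blue; MixedPath]))
    (class_union edgeless complete).
  apply: members_no_K3; first by decide_In.
  by apply: expresses_edgeless_complete; decide_In.
have e_le2 : expresses
    (members (map pgraph [:: K3; Path red; Path blue; MixedPath])) cluster_le2.
  apply: (members_K3 cluster_le2_K3).
  by apply: (expresses_cluster (k := red)); decide_In.
have e_c2 : expresses (members (map pgraph
    [:: K3; Edge red; Edge blue; Path red; Path blue; MixedPath]))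
    (class_union complete (fun G => giso G (edgeless_graph 2))).
  apply: (members_K3 complete_edgeless2_K3).
  by apply: expresses_edgeless_complete; decide_In.
have e_em : expresses (members (map pgraph
    [:: Edge red; Edge blue; Path red; Path blue]))
    (class_union edgeless complete_minus_matching).
  apply: members_no_K3; first by decide_In.
  by apply: expresses_edgeless_matching; decide_In.
have e_KC : expresses (members (map pgraph [:: Edge blue; Path red]))
    (gfree (members [:: disjoint_union (edgeless_graph 1) (path_graph 3);
                        cycle_graph 5])).
  apply: members_no_K3; first by decide_In.
  by apply: (expresses_K1P3_C5 (k := blue)); decide_In.
have e_3C : expresses (members (map pgraph [:: K3; Edge blue; Path red]))
    (gfree (members [:: edgeless_graph 3; cycle_graph 5])).
  apply: (members_K3 gfree_edgeless3_C5E).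
  by apply: (expresses_K1P3_C5 (k := blue)); decide_In.
have e_join : expresses (members (map pgraph
    [:: Edge blue; Path red; MixedPath])) (join_of cluster).
  apply: members_no_K3; first by decide_In.
  by apply: (expresses_join_of_cluster (k := blue)); decide_In.
have e_join2 : expresses (members (map pgraph
    [:: K3; Edge blue; Path red; MixedPath])) (join_of cluster_le2).
  apply: (members_K3 join_of_cluster_le2E).
  by apply: (expresses_join_of_cluster (k := blue)); decide_In.
have e_cc : expresses (members (map pgraph
    [:: Edge blue; Path red; Path blue])) (class_union cobipartite cluster).
  apply: members_no_K3; first by decide_In.
  by apply: (expresses_cobipartite_cluster (k := blue)); decide_In.
have e_cob : expresses (members (map pgraph
    [:: K3; Path red; Path blue])) cobipartite.
  apply: (members_K3 elementary_K3).
  by apply: expresses_elementary; decide_In.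
have e_elem : expresses (members (map pgraph
    [:: Path red; Path blue])) elementary.
  apply: members_no_K3; first by decide_In.
  by apply: expresses_elementary; decide_In.
split; last by repeat (split; [assumption |]); assumption.
move=> C; split=> [[F [F3 FC]]|[D [DC CD]]].
  have [s Fs] := free_avoids F3; have [D DC sD] := classification s.
  exists D; split=> // G; rewrite FC sD.
  by split=> -[c cF]; exists c; apply/Fs.
suff [l lD] : exists l, expresses (members (map pgraph l)) D.
  exists (members (map pgraph l)); split; first exact: members3.
  by move=> G; rewrite CD; apply: lD.
move: DC; do 15?[case=> [<-|]; first by eexists; eassumption].
by case=> [<-|[]]; eexists; eassumption.
Qed.
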